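(* Let $1\leq k<d$ be integers, let $f^{k,d}:\mathbb{R}^k\to\mathbb{R}^d$ be an isometric embedding identifying $\mathbb{R}^k$ with a $k$-dimensional affine subset of $\mathbb{R}^d$, let $\mu$ be a (non-zero) finite Borel measure on $\mathbb{R}^k$ and let $X\subseteq\mathbb{R}^k$ be a non-empty set. Then \[ \dim_{\mathrm F}^{\theta} f^{k,d}_{\#}\mu=\min\{\theta k,\ \dim_{\mathrm F}^{\theta}\mu\} \qquad\text{and}\qquad \dim_{\mathrm F}^{\theta} f^{k,d}(X)=\min\{\theta k,\ \dim_{\mathrm F}^{\theta}X\} \] for all $\theta\in[0,1]$.
   Context: $f^{k,d}_{\#}\mu$ denotes the pushforward of $\mu$ under $f^{k,d}$. For a finite Borel measure $\mu$ on $\mathbb{R}^m$ write $\widehat\mu(z)=\int e^{-2\pi i z\cdot x}\,d\mu(x)$. For $s\geq 0$ and $\theta\in(0,1]$ let $\mathcal{J}_{s,\theta}(\mu)=\left(\int_{\mathbb{R}^m}|\widehat\mu(z)|^{2/\theta}|z|^{s/\theta-m}\,dz\right)^{\theta}$, and let $\mathcal{J}_{s,0}(\mu)=\sup_{z\in\mathbb{R}^m}|\widehat\mu(z)|^2|z|^s$. The Fourier spectrum of $\mu$ at $\theta\in[0,1]$ is $\dim_{\mathrm F}^{\theta}\mu=\sup\{s\geq 0:\mathcal{J}_{s,\theta}(\mu)<\infty\}\in[0,\infty]$, with $\sup\emptyset=0$. For non-empty $X\subseteq\mathbb{R}^m$, $\dim_{\mathrm F}^{\theta}X=\sup\{\min\{\dim_{\mathrm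 F}^{\theta}\mu,m\}:\operatorname{spt}(\mu)\subseteq X\}$, where the supremum is over non-zero finite Borel measures $\mu$ on $\mathbb{R}^m$ whose (closed) support is contained in $X$. The Fourier spectra of $\mu$ and $X$ are computed in $\mathbb{R}^k$ ($m=k$), and those of $f^{k,d}_{\#}\mu$ and $f^{k,d}(X)$ in $\mathbb{R}^d$ ($m=d$). *)

(* Defs.v *)
From HB Require Import structures.
From mathcomp Require Import all_boot all_order all_algebra.
From mathcomp Require Import all_classical all_reals all_analysis measurable_realfun.
From mathcomp Require Import complex.

Set Implicit Arguments.
Unset Strict Implicit.
Unset Printing Implicit Defensive.

Import Order.TTheory GRing.Theory Num.Theory.
Import numFieldNormedType.Exports.

Local Open Scope classical_set_scope.
Local Open Scope ring_scope.

(* Borel sigma-algebra of R^m, so that {finite_measure set 'rV[R]_m -> \bar R}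
   is the type of finite Borel measures on R^m. *)
HB.instance Definition _ (R : realType) (m : nat) :=
  @isMeasurable.Build (sigma_display (@open 'rV[R]_m)) 'rV[R]_m
    <<s @open 'rV[R]_m >> (@sigma_algebra0 _ setT _) (@sigma_algebraC _ _)
    (@sigma_algebra_bigcup _ setT _).

Section lebesgue_measure_rV.
Context {R : realType}.

Definition rV_cons {m} (p : 'rV[R]_m * measurableTypeR R) : 'rV[R]_m.+1 :=
  row_mx (const_mx p.2 : 'rV[R]_1) p.1.

(* The m-fold product of the Lebesgue measure of the line, built through the
   identification of R^m * R with R^(m+1). *)
Fixpoint lebesgue_rV (m : nat) : set 'rV[R]_m -> \bar R :=
  match m with
  | 0 => @dirac _ 'rV[R]_0 0 R
  | m'.+1 => pushforward (@lebesgue_rV m' \x @lebesgue_measure R)%E rV_cons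
  end.

Lemma measurable_fun_rV d (T : measurableType d) m (f : T -> 'rV[R]_m) :
  (forall i, measurable_fun setT (fun t => f t ord0 i : measurableTypeR R)) ->
  measurable_fun setT f.
Proof.
move=> mf.
pose box (q : {ffun 'I_m -> rat * rat}) : set 'rV[R]_m :=
  [set x | forall i, `](ratr (q i).1), (ratr (q i).2)[%classic (x ord0 i)].
apply: (@measurability _ _ _ _ _ _ (@open 'rV[R]_m)) => // _ [U oU <-].
rewrite setTI.
have -> : U = \bigcup_(q in [set q | box q `<=` U]) box q.
  apply/seteqP; split=> [x Ux|x [q qU qx]]; last exact: qU.
  have /= [P Px PU] : nbhs x U by exact: open_nbhs_nbhs.
  have /choice[q hq] : forall i : 'I_m, exists q : rat * rat,
      `](ratr q.1), (ratr q.2)[%classic (x ord0 i) /\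
      `](ratr q.1), (ratr q.2)[%classic `<=` P ord0 i.
    move=> i; have /nbhs_ballP[e /= e0 eP] := Px ord0 i.
    have /rat_in_itvoo[a /itvP ha] : x ord0 i - e < x ord0 i by rewrite ltrBlDr ltrDl.
    have /rat_in_itvoo[b /itvP hb] : x ord0 i < x ord0 i + e by rewrite ltrDl.
    exists (a, b); split=> /=; first by rewrite in_itv/= ha hb.
    move=> y /=; rewrite in_itv/= => /andP[ay yb]; apply: eP.
    rewrite /ball/= ltr_distlC.
    rewrite (lt_trans _ ay) ?ha//= (lt_trans yb)// hb//.
  exists (finfun q) => /=.
    move=> y hy; apply: PU => i j; rewrite ord1.
    by apply: (hq j).2; have := hy j; rewrite ffunE.
  by move=> i; rewrite ffunE; exact: (hq i).1.
rewrite preimage_bigcup bigcup_mkcond.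
apply: countable_bigcupT_measurable => [|q]; first exact: countableP.
case: ifP => // _.
have -> : f @^-1` box q = \bigcap_(i in [set: 'I_m])
    ((fun t => f t ord0 i) @^-1` `](ratr (q i).1), (ratr (q i).2)[%classic).
  by apply/seteqP; split=> t /= ht i; [move=> _; exact: ht|exact: (ht i I)].
apply: fin_bigcap_measurable => // i _.
by rewrite -[X in measurable X]setTI; apply: mf => //; exact: measurable_itv.
Qed.

Lemma measurable_coord_rV m (i : 'I_m) :
  measurable_fun setT (fun x : 'rV[R]_m => x ord0 i : measurableTypeR R).
Proof.
apply: (measurability _ (RGenOInfty.measurableE R)) => _ [_ [a ->] <-].
rewrite setTI; apply: sub_sigma_algebra; apply: open_comp; last exact: rray_open.
by move=> x _; exact: coord_continuous.
Qed.

Lemma measurable_rV_cons m : measurable_fun setT (@rV_cons m).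
Proof.
apply: measurable_fun_rV => i; case: (splitP (i : 'I_(1 + m))) => j ij.
- rewrite [X in measurable_fun _ X](_ : _ = snd); first exact: measurable_snd.
  apply/funext => p; rewrite (_ : i = lshift m j); last exact/val_inj.
  by apply: etrans (row_mxEl _ _ _ _) _; rewrite mxE.
- rewrite [X in measurable_fun _ X](_ : _ =
      (fun x : 'rV[R]_m => x ord0 j : measurableTypeR R) \o fst).
    apply: measurableT_comp; [exact: measurable_coord_rV|exact: measurable_fst].
  apply/funext => p; rewrite (_ : i = rshift 1 j); last exact/val_inj.
  exact: row_mxEr.
Qed.

Let lebesgue_rV_measure m :
  exists nu : {measure set 'rV[R]_m -> \bar R}, nu = @lebesgue_rV m :> (set _ -> _).
Proof.
elim: m => [|m [nu nuE]]; first by exists (@dirac _ 'rV[R]_0 0 R).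
pose mu := (nu \x @lebesgue_measure R)%E.
have mP := @measurable_rV_cons m.
exists (@measure_function_pushforward__canonical__measure_function_Measure _ _ _ _ _ mu _ mP).
by rewrite /= -nuE.
Qed.

Let lebesgue_rV0 m : @lebesgue_rV m set0 = 0%E.
Proof. by have [nu <-] := lebesgue_rV_measure m; exact: measure0. Qed.

Let lebesgue_rV_ge0 m A : (0 <= @lebesgue_rV m A)%E.
Proof. by have [nu <-] := lebesgue_rV_measure m; exact: measure_ge0. Qed.

Let lebesgue_rV_sigma_additive m : semi_sigma_additive (@lebesgue_rV m).
Proof.
by have [nu <-] := lebesgue_rV_measure m; exact: measure_semi_sigma_additive.
Qed.

HB.instance Definition _ m := isMeasure.Build _ _ _ (@lebesgue_rV m)
  (@lebesgue_rV0 m) (@lebesgue_rV_ge0 m) (@lebesgue_rV_sigma_additive m).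

End lebesgue_measure_rV.

Section euclidean.
Context {R : realType}.

Definition dotp {m} (x y : 'rV[R]_m) : R := \sum_(i < m) x ord0 i * y ord0 i.

(* The library norm on 'rV[R]_m is the sup norm; the Euclidean one is needed. *)
Definition enorm {m} (x : 'rV[R]_m) : R := Num.sqrt (dotp x x).

Definition isometric_embedding {k d} (f : 'rV[R]_k -> 'rV[R]_d) : Prop :=
  forall x y, enorm (f x - f y) = enorm (x - y).

Definition affine_subset {d} (k : nat) (A : set 'rV[R]_d) : Prop :=
  exists (b : 'rV[R]_d) (V : 'M[R]_(k, d)),
    row_free V /\ A = range (fun u : 'rV[R]_k => b + u *m V).

End euclidean.

(* The notions below are defined for arbitrary set functions rather than
   bundled measures so that they apply to [pushforward mu f] without carrying
   a proof that f is Borel. *)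
Section fourier_spectrum.
Context {R : realType} {m : nat}.
Implicit Types (mu : set 'rV[R]_m -> \bar R) (s theta : R) (z : 'rV[R]_m).

Definition expi (t : R) : R[i] := Complex (cos t) (sin t).

Definition cintegral mu (F : 'rV[R]_m -> R[i]) : R[i] :=
  Complex (fine (\int[mu]_x (complex.Re (F x))%:E)%E)
          (fine (\int[mu]_x (complex.Im (F x))%:E)%E).

Definition fourier_transform mu z : R[i] :=
  cintegral mu (fun x => expi (- (2 * pi * dotp z x))).

Definition fourier_modulus mu z : R :=
  ComplexField.Normc.normc (fourier_transform mu z).

(* Since 0 `^ a = 0 for a != 0, the integrand is 0 at z = 0 when s / theta < m,
   which only affects a null set. Since 0 `^ 0 = 1, |z|^0 = 1 everywhere. *)
Definition energy s theta mu : \bar R :=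
  if theta == 0 then
    ereal_sup (range (fun z => (fourier_modulus mu z ^+ 2 * enorm z `^ s)%:E))
  else
    ((\int[@lebesgue_rV R m]_z
       (fourier_modulus mu z `^ (2 / theta)
        * enorm z `^ (s / theta - m%:R))%:E) `^ theta)%E.

(* Adjoining 0 implements the convention sup set0 = 0. *)
Definition dimF theta mu : \bar R :=
  ereal_sup (0%E |` [set s%:E | s in [set s | 0 <= s /\ (energy s theta mu < +oo)%E]]).

Definition mspt mu : set 'rV[R]_m :=
  [set x | forall U, open U -> U x -> (0 < mu U)%E].

Definition dimF_set theta (X : set 'rV[R]_m) : \bar R :=
  ereal_sup [set mine (dimF theta mu) m%:R%:E | mu in
    [set mu : {finite_measure set 'rV[R]_m -> \bar R} |
      mu setT <> 0%E /\ mspt mu `<=` X]].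

End fourier_spectrum.

(* Main.v *)
(* An isometric embedding is f x = b + x M with M M^T = 1, so the Fourier modulus
   of f_# mu at z is that of mu at z M^T.  Split R^d as {u M + w N} with N spanning
   the kernel of M^T; by uniqueness of translation-invariant measures, Lebesgue
   measure on R^d is a multiple of du dw, and |u M + w N| is comparable to
   max(|u|, |w|).  With psi = |mu^|^(2/theta), e = s/theta and n = d - k, the energy
   of f_# mu is therefore comparable to
     int psi(u) (int max(|u|, |w|)^(e - d) dw) du.
   The inner integral is comparable to |u|^(e - k) when e < k, which gives the
   energy of mu, and it is infinite when e > k, where the energy diverges because
   psi is bounded below near 0.  For theta = 0 the modulus of f_# mu does not decay
   along ker M^T.  For sets, a measure carried by f(X) is the image under f of its
   image under the left inverse of f. *)

Require Import Defs.
From HB Require Import structures.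
From mathcomp Require Import all_boot all_order all_algebra.
From mathcomp Require Import all_classical all_reals all_analysis measurable_realfun.
From mathcomp Require Import complex ring lra.

Import Order.TTheory GRing.Theory Num.Theory.
Import numFieldNormedType.Exports.

Set Implicit Arguments.
Unset Strict Implicit.
Unset Printing Implicit Defensive.

Local Open Scope classical_set_scope.
Local Open Scope ring_scope.

(** * Lebesgue measure on R^m *)

(** Only finiteness of energies matters, so every comparison may lose a positive factor. This is why
    translation invariance can stand in for a change of variables formula: the determinant of the
    splitting is an unspecified constant c > 0.

    The critical exponent e = k is never examined. A supremum only sees what happens strictly below
    and strictly above it, provided that finiteness of the energy passes to smaller positive
    exponents. That monotonicity rests on psi being bounded, which controls the singularity at the
    origin. It also reduces e > d, where z |-> |z|^(e - d) is increasing in |z| and the comparisons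
    of powers would reverse, to e <= d.

    For sets, pulling a measure back to R^k requires that the complement of its support is null, a
    countable covering argument. The caps k and d in the two dimensions are compatible because theta
    k <= k <= d. *)

Section rV_topology.
Context {R : realType}.

Lemma rV_norm_leP m (x : 'rV[R]_m) (r : R) : 0 <= r ->
  reflect (forall i, `|x ord0 i| <= r) (`|x| <= r).
Proof.
move=> r0; rewrite [`|x|](mx_normrE x); apply/(iffP idP).
  by move=> /bigmax_leP[_ h] i; exact: (h (ord0, i)).
by move=> h; apply/bigmax_leP; split => // -[i j] _ /=; rewrite ord1.
Qed.

Lemma rV_coord_le_norm m (x : 'rV[R]_m) i : `|x ord0 i| <= `|x|.
Proof. exact: (elimT (rV_norm_leP x (normr_ge0 x)) (lexx _)). Qed.

Lemma continuous_measurable_rV m (g : 'rV[R]_m -> R) :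
  continuous g -> measurable_fun setT (g : 'rV[R]_m -> measurableTypeR R).
Proof.
move=> cg; apply: (measurability _ (RGenOInfty.measurableE R)) => _ [_ [a ->] <-].
rewrite setTI; apply: sub_sigma_algebra; apply: open_comp; last exact: rray_open.
by move=> x _; exact: cg.
Qed.

Lemma open_measurable_rV m (U : set 'rV[R]_m) : open U -> measurable U.
Proof. exact: sub_sigma_algebra. Qed.

Lemma measurable_norm_rV m :
  measurable_fun setT ((fun x => `|x|) : 'rV[R]_m -> measurableTypeR R).
Proof. by apply: continuous_measurable_rV => x; exact: norm_continuous. Qed.

Definition cube m (r : R) : set 'rV[R]_m := [set x | `|x| <= r].

Lemma measurable_cube m r : measurable (@cube m r).
Proof.
rewrite -[cube r]setTI.
have -> : cube r = (fun x : 'rV[R]_m => `|x| : measurableTypeR R) @^-1` `]-oo, r].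
  by apply/seteqP; split => x /=; rewrite in_itv.
by apply: measurable_norm_rV => //; exact: measurable_itv.
Qed.

Lemma measurable_addr_rV m (a : 'rV[R]_m) :
  measurable_fun setT (fun x : 'rV[R]_m => x + a).
Proof.
apply: measurable_fun_rV => i.
under eq_fun do rewrite mxE.
by apply: measurable_funD => //; exact: measurable_coord_rV.
Qed.
Lemma measurable_subr_rV m :
  measurable_fun setT (fun p : 'rV[R]_m * 'rV[R]_m => p.2 - p.1).
Proof.
apply: measurable_fun_rV => i.
under eq_fun do rewrite !mxE.
apply: measurable_funB.
  by apply: (measurableT_comp (measurable_coord_rV i)); exact: measurable_snd.
by apply: (measurableT_comp (measurable_coord_rV i)); exact: measurable_fst.
Qed.
Lemma measurable_mulmx_rV m n (M : 'M[R]_(m, n)) :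
  measurable_fun setT (fun x : 'rV[R]_m => x *m M).
Proof.
apply: measurable_fun_rV => i.
under eq_fun do rewrite !mxE.
apply: measurable_sum => j; apply: measurable_funM => //.
exact: measurable_coord_rV.
Qed.

End rV_topology.

Section product_preserving.
Local Open Scope ereal_scope.
Context d1 d2 (T1 : measurableType d1) (T2 : measurableType d2) (R : realType).
Variables (m1 : {measure set T1 -> \bar R}).
Variables (m2 : {sigma_finite_measure set T2 -> \bar R}).

(** The section of the preimage over x is the [h2]-preimage of the section over [h1 x]. Invariance
    of [m2] therefore acts fiberwise, and invariance of [m1] then removes [h1] from the outer
    integral. *)
Lemma product_measure1_preserving (h1 : T1 -> T1) (h2 : T2 -> T2) B :
  measurable_fun setT h1 ->
  (forall A, measurable A -> m1 (h1 @^-1` A) = m1 A) ->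
  (forall A, measurable A -> m2 (h2 @^-1` A) = m2 A) ->
  measurable B ->
  (m1 \x m2) ((fun p => (h1 p.1, h2 p.2)) @^-1` B) = (m1 \x m2) B.
Proof.
move=> mh1 h1E h2E mB; rewrite /product_measure1.
have mph := measurable_fun_xsection m2 mB.
transitivity (\int[m1]_x (((m2 \o xsection B) \o h1) x)).
  apply: eq_integral => x _ /=.
  have -> : xsection ((fun p : T1 * T2 => (h1 p.1, h2 p.2)) @^-1` B) x =
      h2 @^-1` xsection B (h1 x).
    by apply/seteqP; split => y; rewrite /xsection/= !inE.
  by rewrite h2E//; exact: measurable_xsection.
have := @ge0_integral_pushforward _ _ T1 T1 R h1 mh1 m1 setT
  (m2 \o xsection B) measurableT mph.
rewrite preimage_setT => <-; last by move=> *; exact: measure_ge0.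
by apply: eq_measure_integral => A mA _; exact: h1E.
Qed.

End product_preserving.

Section lebesgue_line.
Context {R : realType}.

Lemma lebesgue_measure_translation (a : R) (A : set (measurableTypeR R)) :
  measurable A ->
  (@lebesgue_measure R) ((fun x : measurableTypeR R => x + a : measurableTypeR R) @^-1` A) =
  (@lebesgue_measure R) A.
Proof.
have mf : measurable_fun setT (fun x : measurableTypeR R => x + a : measurableTypeR R).
  exact: measurable_funD.
move=> mA.
pose nu := measure_function_pushforward__canonical__measure_function_Measure
  (@lebesgue_measure R) mf.
apply/esym; apply: (@lebesgue_measure_unique R nu) => // _ [[b c]] _ <-.
rewrite /= /pushforward.
have -> : (fun x : R => x + a) @^-1` `]b, c] = `]b - a, c - a]%classic.
  by apply/seteqP; split => x /=; rewrite !in_itv/= ltrBlDr lerBrDr.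
rewrite !lebesgue_measure_itv/= !lte_fin ltrD2r.
by case: ifP => // _; rewrite -!EFinB opprB addrA subrK.
Qed.

End lebesgue_line.

Section lebesgue_rV_theory.
Context {R : realType}.
Local Notation lam m := (@lebesgue_rV R m).

Lemma lebesgue_rV_translation m (a : 'rV[R]_m) A : measurable A ->
  lam m ((fun x => x + a) @^-1` A) = lam m A.
Proof.
elim: m a A => [|m IH] a A mA.
  have -> : (fun x : 'rV[R]_0 => x + a) @^-1` A = A.
    by apply/seteqP; split => x /=; rewrite [x + a]thinmx0 [x]thinmx0.
  by [].
rewrite /= /pushforward.
pose a' : 'rV[R]_m := rsubmx (a : 'rV[R]_(1 + m)).
pose a0 := (a : 'rV[R]_(1 + m)) ord0 (lshift m ord0).
pose h1 := fun x : 'rV[R]_m => x + a'.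
pose h2 := fun x : measurableTypeR R => x + a0 : measurableTypeR R.
(* Through [rV_cons], the shift by [a] becomes a product of shifts, by the tail [a'] and by the
   first coordinate [a0]. *)
have -> : rV_cons @^-1` ((fun x => x + a) @^-1` A) =
    (fun p => (h1 p.1, h2 p.2)) @^-1` (rV_cons @^-1` A).
  have E x y : rV_cons (x, y) + a = rV_cons (h1 x, h2 y).
    rewrite /rV_cons/= -[a in LHS](@hsubmxK _ 1 1 m) -/a'.
    apply: etrans (@add_row_mx _ 1 1 m _ _ _ _) _.
    congr row_mx; apply/rowP => i; rewrite !mxE /h2 /a0 ord1.
    by congr (_ + (a : 'rV[R]_(1 + m)) _ _); exact/val_inj.
  by apply/seteqP; split => -[x y]; rewrite /preimage/= E.
apply: product_measure1_preserving.
- exact: measurable_addr_rV.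
- by move=> B mB; exact: IH.
- by move=> B mB; exact: lebesgue_measure_translation.
- by rewrite -[X in measurable X]setTI; exact: measurable_rV_cons.
Qed.

Lemma rV_consl m (p : 'rV[R]_m * measurableTypeR R) j :
  rV_cons p ord0 (lshift m (j : 'I_1)) = p.2.
Proof. by apply: etrans (row_mxEl _ _ _ _) _; rewrite mxE. Qed.

Lemma rV_consr m (p : 'rV[R]_m * measurableTypeR R) j :
  rV_cons p ord0 (rshift 1 j) = p.1 ord0 j.
Proof. exact: row_mxEr. Qed.

Lemma lebesgue_rV_cube m (r : R) : 0 <= r -> lam m (cube r) = ((2 * r) ^+ m)%:E.
Proof.
move=> r0; elim: m => [|m IH].
  by rewrite /= diracE expr0 mem_set// /cube/= normr0.
rewrite /= /pushforward.
have -> : rV_cons @^-1` (@cube R m.+1 r) = (@cube R m r) `*` `[- r, r]%classic.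
  apply/seteqP; split => -[x y].
    rewrite /cube/= => /(rV_norm_leP _ r0) h; split.
      apply/(rV_norm_leP _ r0) => i.
      by have := h (rshift 1 i); rewrite rV_consr.
    by have := h (lshift m (ord0 : 'I_1)); rewrite rV_consl in_itv/= -ler_norml.
  rewrite /cube/= in_itv/= -ler_norml => -[/(rV_norm_leP _ r0) h hy].
  apply/(rV_norm_leP _ r0) => i; case: (splitP (i : 'I_(1 + m))) => j ij.
    by rewrite (_ : i = lshift m j) ?rV_consl//; exact/val_inj.
  by rewrite (_ : i = rshift 1 j) ?rV_consr//; exact/val_inj.
transitivity (lam m (cube r) * (@lebesgue_measure R) [set` `[(- r)%R, r]])%E.
  by apply: product_measure1E => //; exact: measurable_cube.
rewrite IH lebesgue_measure_itv/= lte_fin.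
case: ltP => hr.
  by rewrite -EFinB -EFinM exprSr;
    congr (_ * _)%:E; rewrite opprK mulr2n mulrDl !mul1r.
(* Degenerate interval: the formula for interval lengths returns 0, and so does the power, whose
   exponent is a successor. *)
have -> : r = 0 by lra.
by rewrite mule0 mulr0 expr0n.
Qed.

Lemma lebesgue_rV_cube_lty m (r : R) : (lam m (cube r) < +oo)%E.
Proof.
have [r0|r0] := leP 0 r; first by rewrite lebesgue_rV_cube// ltry.
rewrite (_ : cube r = set0) ?measure0//.
by apply/seteqP; split => x //=; rewrite /cube/= leNgt (lt_le_trans r0).
Qed.

Lemma bigcup_cube m : \bigcup_n (@cube R m n%:R) = setT.
Proof.
apply/seteqP; split => // x _.
exists (Num.trunc `|x|).+1 => //; rewrite /cube/=.
by rewrite ltW// truncnS_gt.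
Qed.

Lemma lebesgue_rV_sigma_finite m : sigma_finite setT (lam m).
Proof.
exists (fun n => cube n%:R); first by rewrite bigcup_cube.
move=> n; split; [exact: measurable_cube|exact: lebesgue_rV_cube_lty].
Qed.

HB.instance Definition _ m := @Measure_isSigmaFinite.Build _ _ _ (lam m)
  (@lebesgue_rV_sigma_finite m).

Lemma cube0 m : @cube R m 0 = [set 0].
Proof.
by apply/seteqP; split => x; rewrite /cube/= normr_le0 => /eqP.
Qed.

Lemma lebesgue_rV_set1 m : (0 < m)%N -> lam m [set 0] = 0%E.
Proof.
by move=> m0; rewrite -cube0 lebesgue_rV_cube// mulr0 expr0n eqn0Ngt m0.
Qed.

End lebesgue_rV_theory.

(** * Uniqueness of translation-invariant measures *)

(** Repackaging: the Fubini argument below takes a bundled sigma-finite measure, whereas a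
    pushforward is only known to be a measure until its sigma-finiteness is proved. *)
Lemma sigma_finite_measureW d (T : measurableType d) (R : realType)
    (mu : {measure set T -> \bar R}) :
  sigma_finite setT mu ->
  exists mu' : {sigma_finite_measure set T -> \bar R}, mu' = mu :> (set T -> \bar R).
Proof.
move=> H.
pose H2 := isSFinite.Build _ _ _ _ (sfinite_measure_sigma_finite H).
pose H3 := isSigmaFinite.Build _ _ _ _ H.
by exists (HB.pack_for (SigmaFiniteMeasure.type T R) (Measure.sort mu) H2 H3).
Qed.

Section haar_uniqueness.
Context {R : realType}.
Local Notation lam m := (@lebesgue_rV R m).

(* Both sides are the measure of [set (x, y) | x \in A, y - x \in B] under
   nu \x lebesgue, computed along x and, after the shift x |-> x + y, along y. *)
Lemma translation_invariant_proportional m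
    (nu : {sigma_finite_measure set 'rV[R]_m -> \bar R}) (A B : set 'rV[R]_m) :
  (forall (a : 'rV[R]_m) (E : set 'rV[R]_m), measurable E ->
     nu ((fun x => x + a) @^-1` E) = nu E) ->
  measurable A -> measurable B ->
  (nu A * lam m B = nu (-%R @^-1` B) * lam m A)%E.
Proof.
move=> nuT mA mB.
have mN : measurable_fun setT (-%R : 'rV[R]_m -> 'rV[R]_m).
  apply: measurable_fun_rV => i; under eq_fun do rewrite mxE.
  by apply: measurableT_comp => //; exact: measurable_coord_rV.
have mD : measurable_fun setT (fun p : 'rV[R]_m * 'rV[R]_m => p.1 + p.2).
  apply: measurable_fun_rV => i; under eq_fun do rewrite mxE.
  by apply: measurable_funD; apply: (measurableT_comp (measurable_coord_rV i)).
have mNB : measurable (-%R @^-1` B) by rewrite -[X in measurable X]setTI; exact: mN.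
pose E := [set p : 'rV[R]_m * 'rV[R]_m | A p.1 /\ B (p.2 - p.1)].
pose E' := [set p : 'rV[R]_m * 'rV[R]_m | A (p.1 + p.2) /\ B (- p.1)].
have mE : measurable E.
  have -> : E = (fst @^-1` A) `&` ((fun p => p.2 - p.1) @^-1` B) by [].
  apply: measurableI; rewrite -[X in measurable X]setTI.
    exact: measurable_fst.
  exact: measurable_subr_rV.
have mE' : measurable E'.
  have -> : E' = ((fun p => p.1 + p.2) @^-1` A) `&` (fst @^-1` (-%R @^-1` B)) by [].
  apply: measurableI; rewrite -[X in measurable X]setTI; first exact: mD.
  exact: measurable_fst.
(* Tonelli for sets: both iterated integrals are measures with the product values on rectangles, so
   they coincide. *)
have swap X : measurable X -> (\int[nu]_x lam m (xsection X x) =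
    \int[lam m]_y nu (ysection X y))%E.
  move=> mX; have := @product_measure_unique _ _ _ _ _ nu (lam m)
    (nu \x^ lam m)%E _ X mX; apply.
  by move=> C D mC mD'; exact: product_measure2E.
have intE (C : set 'rV[R]_m) (c : \bar R) : measurable C ->
    (0 <= c)%E -> (\int[nu]_x ((\1_C x)%:E * c) = nu C * c)%E.
  move=> mC c0; rewrite ge0_integralZr//; first by rewrite integral_indic// setIT.
  exact: measurableT_comp.
rewrite -(intE A)// -(intE (-%R @^-1` B))//.
transitivity (\int[nu]_x lam m (xsection E x))%E.
  apply: eq_integral => x _; rewrite indicE; have [xA|xA] := boolP (x \in A).
    rewrite mul1e -(lebesgue_rV_translation (- x) mB); congr (lam m _).
    apply/seteqP; split => y; rewrite /xsection/= inE /E/=; last by case.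
    by move=> By; split => //; exact: set_mem.
  rewrite mul0e (_ : xsection E x = set0) ?measure0//.
  apply/seteqP; split => y //; rewrite /xsection/= inE /E/= => -[/mem_set].
  by rewrite (negbTE xA).
transitivity (\int[nu]_x lam m (xsection E' x))%E; last first.
  apply: eq_integral => x _; rewrite indicE; have [xB|xB] := boolP (x \in _).
    rewrite mul1e -(lebesgue_rV_translation x mA); congr (lam m _).
    apply/seteqP; split => y; rewrite /xsection/= inE /E'/= addrC.
      by move=> [].
    by move=> Ay; split => //; exact: set_mem.
  rewrite mul0e (_ : xsection E' x = set0) ?measure0//.
  apply/seteqP; split => y //; rewrite /xsection/= inE /E'/= => -[_ Bx].
  by rewrite mem_set in xB.
rewrite !swap//; apply: eq_integral => y _.
rewrite -(nuT y); last exact: measurable_ysection.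
congr (nu _); apply/seteqP; split => x; rewrite /ysection/= !inE /E /E'/=;
 by rewrite opprD addrCA subrr addr0.
Qed.

End haar_uniqueness.

(** * Lebesgue measure in the coordinates of a direct sum decomposition *)

Section linear_change_of_variables.
Context {R : realType}.
Local Notation lam m := (@lebesgue_rV R m).

Lemma mulmx_rV_bounded m n (A : 'M[R]_(m, n)) :
  exists2 C : R, 0 < C & forall x : 'rV[R]_m, `|x *m A| <= C * `|x|.
Proof.
(* The summand 1 keeps the constant positive when the matrix is zero or empty. *)
exists (1 + \sum_i \sum_j `|A i j|); first by rewrite ltr_wpDr// !sumr_ge0//
  => i _; exact: sumr_ge0.
move=> x; apply/rV_norm_leP => [|j].
  by rewrite mulr_ge0// addr_ge0// !sumr_ge0// => i _; exact: sumr_ge0.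
rewrite mxE; apply: (le_trans (ler_norm_sum _ _ _)).
rewrite mulrDl mul1r ler_wpDl// mulr_suml; apply: ler_sum => i _.
rewrite normrM mulrC ler_pM//; last exact: rV_coord_le_norm.
by rewrite (bigD1 j)//= lerDl sumr_ge0.
Qed.

Lemma lebesgue_rV_prod_cube k n (r s : R) :
  ((lam k \x lam n)%E (cube r `*` cube s) = lam k (cube r) * lam n (cube s))%E.
Proof.
by apply: (@product_measure1E _ _ _ _ _ (lam k) (lam n)); exact: measurable_cube.
Qed.

Variables (k n d : nat) (M : 'M[R]_(k, d)) (N : 'M[R]_(n, d)).
Variables (M' : 'M[R]_(d, k)) (N' : 'M[R]_(d, n)).
Hypotheses (MM' : M *m M' = 1%:M) (NN' : N *m N' = 1%:M).
Hypotheses (NM' : N *m M' = 0) (MN' : M *m N' = 0).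
Hypothesis (MMNN : M' *m M + N' *m N = 1%:M).

(** The hypotheses say exactly that x |-> (x M', x N') is the two-sided inverse of this map. *)
Definition row_sum (p : 'rV[R]_k * 'rV[R]_n) : 'rV[R]_d := p.1 *m M + p.2 *m N.

Lemma measurable_row_sum : measurable_fun setT row_sum.
Proof.
apply: measurable_fun_rV => i; under eq_fun do rewrite !mxE.
by apply: measurable_funD; apply: measurable_sum => j; apply: measurable_funM => //;
  apply: (measurableT_comp (measurable_coord_rV j)).
Qed.

Local Notation nu := (measure_function_pushforward__canonical__measure_function_Measure
  (lam k \x lam n)%E measurable_row_sum).

(** The inverse of [row_sum] is bounded, so the preimage of a cube lies in a product of cubes. *)
Lemma row_sum_cube_lty r : (nu (cube r) < +oo)%E.
Proof.
have [A A0 hA] := mulmx_rV_bounded M'.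
have [B B0 hB] := mulmx_rV_bounded N'.
apply: (@le_lt_trans _ _ ((lam k \x lam n)%E (cube (A * r) `*` cube (B * r)))).
  rewrite [leLHS]/= /pushforward.
  apply: le_measure; rewrite ?inE.
  - rewrite -[X in measurable X]setTI; apply: measurable_row_sum => //.
    exact: measurable_cube.
  - by apply: measurableX; exact: measurable_cube.
  - move=> [u w]; rewrite /cube/preimage/= => h.
    have uE : u = row_sum (u, w) *m M'.
      by rewrite mulmxDl -!mulmxA MM' NM' mulmx1 mulmx0 addr0.
    have wE : w = row_sum (u, w) *m N'.
      by rewrite mulmxDl -!mulmxA MN' NN' mulmx1 mulmx0 add0r.
    by split; [rewrite uE (le_trans (hA _))//|rewrite wE (le_trans (hB _))//];
      rewrite ler_pM2l.
rewrite lebesgue_rV_prod_cube.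
by apply: lte_mul_pinfty => //; [rewrite ge0_fin_numE//|]; exact: lebesgue_rV_cube_lty.
Qed.

Lemma row_sum_cube1_gt0 : (0 < nu (cube 1))%E.
Proof.
have [A A0 hA] := mulmx_rV_bounded M.
have [B B0 hB] := mulmx_rV_bounded N.
(* With these radii each of the two summands of [row_sum] has norm at most 1/2. *)
have A2 : 0 < (2 * A)^-1 by rewrite invr_gt0 mulr_gt0.
have B2 : 0 < (2 * B)^-1 by rewrite invr_gt0 mulr_gt0.
apply: (@lt_le_trans _ _ ((lam k \x lam n)%E (cube (2 * A)^-1 `*` cube (2 * B)^-1))).
  rewrite lebesgue_rV_prod_cube !lebesgue_rV_cube ?ltW// -EFinM lte_fin.
  by rewrite mulr_gt0// exprn_gt0// mulr_gt0.
rewrite [leRHS]/= /pushforward; apply: le_measure; rewrite ?inE.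
- by apply: measurableX; exact: measurable_cube.
- rewrite -[X in measurable X]setTI; apply: measurable_row_sum => //.
  exact: measurable_cube.
- move=> [u w]; rewrite /cube/preimage/= => -[hu hw].
  rewrite (le_trans (ler_normD _ _))// (splitr 1) lerD//.
    rewrite (le_trans (hA _))// mulrC -ler_pdivlMr// (le_trans hu)//.
    by rewrite invfM mul1r.
  rewrite (le_trans (hB _))// mulrC -ler_pdivlMr// (le_trans hw)//.
  by rewrite invfM mul1r.
Qed.

(** The pushforward is translation invariant, since a shift by [a] in R^d is the shift by (a M', a
    N') upstairs. It is thus proportional to Lebesgue measure; evaluating on the unit cube gives the
    factor, finite and positive by the two preceding bounds. *)
Lemma pushforward_row_sum : exists2 c : R, 0 < c & forall A, measurable A ->
  pushforward (lam k \x lam n)%E row_sum A = (c%:E * lam d A)%E.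
Proof.
have sf : sigma_finite setT nu.
  exists (fun j => cube j%:R); first by rewrite bigcup_cube.
  by move=> j; split; [exact: measurable_cube|exact: row_sum_cube_lty].
have [nu' nuE] := sigma_finite_measureW sf.
have nuT (a : 'rV[R]_d) (E : set 'rV[R]_d) : measurable E ->
    nu' ((fun x => x + a) @^-1` E) = nu' E.
  move=> mE; rewrite nuE/= /pushforward.
  have -> : row_sum @^-1` ((fun x => x + a) @^-1` E) =
     (fun p => (p.1 + a *m M', p.2 + a *m N')) @^-1` (row_sum @^-1` E).
    have e p : row_sum p + a = row_sum (p.1 + a *m M', p.2 + a *m N').
      rewrite /row_sum/= !mulmxDl -!mulmxA addrACA -mulmxDr MMNN.
      by rewrite mulmx1.
    by apply/seteqP; split => p; rewrite /preimage/= e.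
  apply: (@product_measure1_preserving _ _ _ _ _ (lam k) (lam n)
    (fun x => x + a *m M') (fun x => x + a *m N')).
  - exact: measurable_addr_rV.
  - by move=> A mA; exact: lebesgue_rV_translation.
  - by move=> A mA; exact: lebesgue_rV_translation.
  - rewrite -[X in measurable X]setTI; exact: measurable_row_sum.
have c0 : (0 < nu' (cube 1))%E by rewrite nuE; exact: row_sum_cube1_gt0.
have cy : (nu' (cube 1) < +oo)%E by rewrite nuE; exact: row_sum_cube_lty.
have cfin : nu' (cube 1) \is a fin_num by rewrite ge0_fin_numE// ltW.
exists (fine (nu' (cube 1)) / (2 * 1) ^+ d).
  by rewrite divr_gt0// ?fine_gt0 ?c0 ?cy// exprn_gt0.
move=> A mA; have := translation_invariant_proportional nuT mA (@measurable_cube R d 1).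
rewrite lebesgue_rV_cube//.
(* The test set is symmetric, so the reflection in the proportionality identity disappears. *)
have -> : -%R @^-1` (@cube R d 1) = cube 1.
  by apply/seteqP; split => x; rewrite /cube/preimage/= normrN.
move=> h.
have -> : pushforward (lam k \x lam n)%E row_sum A =
    (nu' A * ((2 * 1) ^+ d)%:E * ((2 * 1) ^- d)%:E)%E.
  by rewrite -muleA -EFinM divff ?mule1 ?nuE// expf_neq0// mulr1.
by rewrite h EFinM fineK// muleAC.
Qed.

End linear_change_of_variables.

(** * Euclidean norm and power integrals *)

Section euclidean_norm.
Context {R : realType}.

Lemma dotpE m (x y : 'rV[R]_m) : dotp x y = (x *m y^T) ord0 ord0.
Proof. by rewrite /dotp mxE; apply: eq_bigr => i _; rewrite mxE. Qed.

Lemma dotpC m (x y : 'rV[R]_m) : dotp x y = dotp y x.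
Proof. by apply: eq_bigr => i _; rewrite mulrC. Qed.

Lemma dotpDl m (x y z : 'rV[R]_m) : dotp (x + y) z = dotp x z + dotp y z.
Proof. by rewrite !dotpE mulmxDl mxE. Qed.

Lemma dotpNl m (x z : 'rV[R]_m) : dotp (- x) z = - dotp x z.
Proof. by rewrite !dotpE mulNmx mxE. Qed.

Lemma dotpZl m a (x z : 'rV[R]_m) : dotp (a *: x) z = a * dotp x z.
Proof. by rewrite !dotpE -scalemxAl mxE. Qed.

Lemma dotp_mulmx m n (M : 'M[R]_(m, n)) x y :
  dotp (x *m M) y = dotp x (y *m M^T).
Proof. by rewrite !dotpE trmx_mul trmxK mulmxA. Qed.

Lemma dotp0l m (x : 'rV[R]_m) : dotp 0 x = 0.
Proof. by rewrite dotpE mul0mx mxE. Qed.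

Lemma dotpp_ge0 m (x : 'rV[R]_m) : 0 <= dotp x x.
Proof. by apply: sumr_ge0 => i _; rewrite -expr2 sqr_ge0. Qed.

Lemma dotpp_eq0 m (x : 'rV[R]_m) : dotp x x = 0 -> x = 0.
Proof.
move=> /psumr_eq0P h; apply/rowP => i; rewrite mxE; apply/eqP.
by rewrite -sqrf_eq0 expr2 h// => j _; rewrite -expr2 sqr_ge0.
Qed.

Lemma enorm_ge0 m (x : 'rV[R]_m) : 0 <= enorm x.
Proof. exact: sqrtr_ge0. Qed.

Lemma enorm_sqr m (x : 'rV[R]_m) : enorm x ^+ 2 = dotp x x.
Proof. by rewrite /enorm sqr_sqrtr// dotpp_ge0. Qed.

Lemma norm_le_enorm m (x : 'rV[R]_m) : `|x| <= enorm x.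
Proof.
apply/rV_norm_leP => [|i]; first exact: enorm_ge0.
rewrite -ler_sqr ?nnegrE ?enorm_ge0// enorm_sqr -normrX ger0_norm ?sqr_ge0//.
rewrite /dotp (bigD1 i)//= expr2 lerDl sumr_ge0// => j _.
by rewrite -expr2 sqr_ge0.
Qed.

Lemma enorm_le_norm m (x : 'rV[R]_m) : enorm x <= m%:R * `|x|.
Proof.
rewrite -ler_sqr ?nnegrE ?enorm_ge0 ?mulr_ge0// enorm_sqr.
apply: (@le_trans _ _ (\sum_(i < m) `|x| ^+ 2)).
  apply: ler_sum => i _; rewrite -expr2 -[leLHS]ger0_norm ?sqr_ge0// normrX.
  by rewrite lerXn2r ?nnegrE// rV_coord_le_norm.
rewrite sumr_const card_ord -[leLHS]mulr_natl exprMn ler_wpM2r ?sqr_ge0//.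
by rewrite -natrX ler_nat; case: (m) => // k; rewrite expnS expn1 leq_pmulr.
Qed.

Lemma enorm_gt0 m (x : 'rV[R]_m) : x != 0 -> 0 < enorm x.
Proof. by move=> x0; apply: lt_le_trans (norm_le_enorm x); rewrite normr_gt0. Qed.

Lemma enorm0 m : enorm (0 : 'rV[R]_m) = 0.
Proof. by rewrite /enorm dotp0l sqrtr0. Qed.

Lemma measurable_enorm m :
  measurable_fun setT ((fun x => enorm x) : 'rV[R]_m -> measurableTypeR R).
Proof.
rewrite (_ : (fun x => _) = (fun x : 'rV[R]_m => dotp x x `^ 2^-1)); last first.
  by apply/funext => x; rewrite /enorm powR12_sqrt// dotpp_ge0.
apply: (measurableT_comp (measurable_powR 2^-1)).
by apply: measurable_sum => i; apply: measurable_funM => //; exact: measurable_coord_rV.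
Qed.

Lemma measurable_enorm_powR m p :
  measurable_fun setT ((fun x => enorm x `^ p) : 'rV[R]_m -> measurableTypeR R).
Proof. exact: (measurableT_comp (measurable_powR p) (@measurable_enorm m)). Qed.

(** Positivity of [x] is essential: for p < 0 the convention makes the p-th power of 0 equal to 0,
    not infinity. The same convention is why the origin is set apart throughout. *)
Lemma le0_ger_powR (p x y : R) : p <= 0 -> 0 < x -> x <= y -> y `^ p <= x `^ p.
Proof.
move=> p0 x0 xy; have y0 := lt_le_trans x0 xy.
rewrite -[p]opprK !(powRN _ (- p)) lef_pV2 ?posrE ?powR_gt0//.
by rewrite ge0_ler_powR ?oppr_ge0// nnegrE ltW.
Qed.

End euclidean_norm.

Section dyadic.
Context {R : realType}.
Local Notation lam m := (@lebesgue_rV R m).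

Lemma dyadic_witness (q : R) (x : R) : 0 < x <= 1 -> 0 < q < 1 ->
  exists j, q ^+ j.+1 < x <= q ^+ j.
Proof.
move=> /andP[x0 x1] /andP[q0 q1].
have [n hn] : exists n, q ^+ n < x.
  have : (fun n => q ^+ n) @ \oo --> (0 : R).
    by apply: cvg_expr; rewrite ger0_norm// ltW.
  move=> /cvgr0Pnorm_lt /(_ x x0)[n _ /(_ n (leqnn n))]/=.
  by rewrite ger0_norm ?exprn_ge0 ?(ltW q0)//; exists n.
have ex : exists n, q ^+ n < x by exists n.
(* [j] is the predecessor of the least exponent whose power falls below [x]; that exponent is not 0
   because x <= 1. *)
have := ex_minnP ex => -[[|j] hj jmin]; first by rewrite expr0 ltNge x1 in hj.
exists j; rewrite hj/= leNgt; apply/negP => /jmin.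
by rewrite ltnn.
Qed.

(** [g] is dominated by the sum over j of A b^j times the indicator of the cube of radius rho q^j,
    whose integrals form a geometric series of ratio b q^m. Taking q < 1 handles a singularity at
    the origin, and q > 1 a tail at infinity. *)
Lemma integral_dyadic_le m (g : 'rV[R]_m -> R) (A b q rho : R) :
  measurable_fun setT (g : _ -> measurableTypeR R) -> (forall x, 0 <= g x) ->
  0 <= A -> 0 <= b -> 0 <= q -> 0 <= rho -> b * q ^+ m < 1 ->
  (forall x, g x != 0 -> exists j, g x <= A * b ^+ j /\ `|x| <= rho * q ^+ j) ->
  (\int[lam m]_x (g x)%:E <= (A * (2 * rho) ^+ m / (1 - b * q ^+ m))%:E)%E.
Proof.
move=> mg g0 A0 b0 q0 rho0 t1 hg.
set t := b * q ^+ m in t1 *.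
have t0 : 0 <= t by rewrite mulr_ge0// exprn_ge0.
pose h j (x : 'rV[R]_m) : \bar R := ((A * b ^+ j)%:E * (\1_(cube (rho * q ^+ j)) x)%:E)%E.
have h0 j x : (0 <= h j x)%E by rewrite mule_ge0// lee_fin// mulr_ge0// exprn_ge0.
have mh j : measurable_fun setT (h j).
  apply: measurable_funeM; apply/measurable_EFinP.
  by apply: measurable_indic; exact: measurable_cube.
apply: (@le_trans _ _ (\int[lam m]_x (\sum_(0 <= j <oo) h j x))%E).
  apply: ge0_le_integral => //.
  - by move=> x _; rewrite lee_fin.
  - exact/measurable_EFinP.
  - by apply: ge0_emeasurable_sum => // j x _.
  - move=> x _; have [gx0|/hg[j [gj xj]]] := eqVneq (g x) 0.
      by rewrite gx0; apply: nneseries_ge0.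
    apply: le_trans (@nneseries_lim_ge _ _ xpredT 0 j.+1 _) => //.
    rewrite big_nat_recr//=; apply: (@le_trans _ _ (h j x)); last first.
      by rewrite leeDr// sume_ge0.
    by rewrite /h indicE mem_set// mule1 lee_fin.
rewrite integral_nneseries//.
have hE j : (\int[lam m]_x h j x = (A * (2 * rho) ^+ m * t ^+ j)%:E)%E.
  rewrite ge0_integralZl//; last 2 first.
  - apply/measurable_EFinP; apply: measurable_indic; exact: measurable_cube.
  - by rewrite lee_fin mulr_ge0// exprn_ge0.
  rewrite integral_indic ?setIT//; last exact: measurable_cube.
  rewrite [X in (_ * X)%E]lebesgue_rV_cube; last by rewrite mulr_ge0// exprn_ge0.
  rewrite -EFinM; congr (_%:E); rewrite /t !exprMn -!exprM (mulnC j m).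
  ring.
apply: lime_le; first by apply: is_cvg_nneseries => j _ _; exact: integral_ge0.
near=> n; under eq_bigr do rewrite hE.
rewrite sumEFin lee_fin.
have := @geometric_seriesE R (A * (2 * rho) ^+ m) t.
move=> /(_ (negbT (lt_eqF t1)))/(congr1 (@^~ n))/=; rewrite /series/= => ->.
rewrite ler_wpM2r ?invr_ge0 ?subr_ge0 ?(ltW t1)// ler_piMr//.
  by rewrite mulr_ge0// exprn_ge0// mulr_ge0.
by rewrite lerBlDr lerDl exprn_ge0.
Unshelve. all: by end_near. Qed.

End dyadic.

Section power_integrals.
Context {R : realType}.
Local Notation lam m := (@lebesgue_rV R m).

(** On the shell 2^-(j+1) < |x| <= 2^-j the power is at most (2^-p)^(j+1), which dictates A = b =
    2^-p and q = 1/2. The ratio 2^-(p+m) is below 1 exactly when p > -m. *)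
Lemma integral_enorm_powR_cube1_lty m (p : R) : - m%:R < p < 0 ->
  (\int[lam m]_x (enorm x `^ p * \1_(cube 1) x)%:E < +oo)%E.
Proof.
move=> /andP[mp p0].
have h0 : (0 : R) < 2^-1 by rewrite invr_gt0.
have h1 : (2^-1 : R) < 1 by rewrite invf_lt1// ltr1n.
apply: le_lt_trans (@integral_dyadic_le R m _ (2^-1 `^ p) (2^-1 `^ p) 2^-1 1
  _ _ _ _ _ _ _ _) (ltry _) => //; try exact: powR_ge0.
- apply: measurable_funM; first exact: measurable_enorm_powR.
  by apply: measurable_indic; exact: measurable_cube.
- by move=> x; rewrite mulr_ge0// powR_ge0.
- rewrite -powR_mulrn ?(ltW h0)// -powRD; last first.
    by apply/implyP => _; rewrite gt_eqF.
  rewrite /powR (gt_eqF h0) -[ltRHS]expR0 ltr_expR pmulr_rlt0.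
    by rewrite ln_lt0// h0.
  by rewrite -ltrBlDr sub0r.
move=> x; rewrite mulf_eq0 negb_or powR_eq0 negb_and => /andP[].
rewrite negbK (lt_eqF p0) orbF => ex0; rewrite indicE pnatr_eq0 eqb0 negbK.
move=> /set_mem xc; rewrite mem_set// mulr1.
have nx : 0 < `|x|.
  by rewrite normr_gt0; apply: contraNneq ex0 => ->; rewrite enorm0.
have [||j /andP[jx xj]] := @dyadic_witness R 2^-1 `|x|; first by rewrite nx.
  by rewrite h0.
exists j; rewrite mul1r; split => //.
rewrite -exprS -powR_mulrn ?powR_ge0// -powRrM mulrC powRrM powR_mulrn ?(ltW h0)//.
apply: le0_ger_powR => //; rewrite ?exprn_gt0// ?(ltW p0)//.
by apply: le_trans (ltW jx) _; exact: norm_le_enorm.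
Qed.

(** Dyadic shells growing outwards from radius r: q = 2 and b = 2^p, with ratio 2^(p+n) < 1. The
    scale r enters through A and rho and yields the factor r^(p+n). *)
Lemma integral_max_powR_le n (p : R) : p < - n%:R ->
  exists2 C : R, 0 < C & forall r, 0 < r ->
  (\int[lam n]_w (Num.max r `|w| `^ p)%:E <= (C * r `^ (p + n%:R))%:E)%E.
Proof.
move=> pn.
have p0 : p < 0 by rewrite (lt_le_trans pn)// oppr_le0.
have b1 : 2 `^ p * 2 ^+ n < 1 :> R.
  rewrite -powR_mulrn// -powRD; last by apply/implyP => _; rewrite pnatr_eq0.
  rewrite /powR pnatr_eq0/= -[ltRHS]expR0 ltr_expR nmulr_rlt0 ?ln_gt0 ?ltr1n//.
  by rewrite -ltrBrDr sub0r.
exists (2^-1 `^ p * 2 ^+ n / (1 - 2 `^ p * 2 ^+ n)).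
  by rewrite divr_gt0 ?subr_gt0// mulr_gt0// ?powR_gt0 ?invr_gt0 ?exprn_gt0.
move=> r r0.
apply: le_trans (@integral_dyadic_le R n _ ((2^-1 * r) `^ p) (2 `^ p) 2 r
  _ _ _ _ _ _ _ _) _ => //; try exact: powR_ge0; try exact: ltW.
- apply: (measurableT_comp (measurable_powR p)).
  by apply: measurable_maxr => //; exact: measurable_norm_rV.
- by move=> w; exact: powR_ge0.
- move=> w _; set x := Num.max r `|w|.
  have rx : r <= x by rewrite le_max lexx.
  have x0 := lt_le_trans r0 rx.
  have [||j /andP[jx xj]] := @dyadic_witness R 2^-1 (r / x).
  + by rewrite divr_gt0//= ler_pdivrMr// mul1r.
  + by rewrite invr_gt0 ltr0n/= invf_lt1// ltr1n.
  have e2 : 2 ^+ j != 0 :> R by rewrite expf_neq0.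
  (* Here 2^j r <= x < 2^(j+1) r. The outer radius forces the index j+1, and the factor 1/2 in A
     compensates the shift in the lower bound for x. *)
  exists j.+1; split.
    have -> : (2 `^ p) ^+ j.+1 = (2 ^+ j.+1) `^ p.
      by rewrite -powR_mulrn ?powR_ge0// -powRrM mulrC powRrM powR_mulrn.
    rewrite -powRM ?mulr_ge0 ?exprn_ge0 ?invr_ge0 ?(ltW r0)//.
    apply: le0_ger_powR; rewrite ?(ltW p0) ?mulr_gt0 ?exprn_gt0 ?invr_gt0//.
    have -> : 2^-1 * r * 2 ^+ j.+1 = r * 2 ^+ j by rewrite exprS; field.
    by move: xj; rewrite ler_pdivrMr// exprVn mulrC ler_pdivlMr// exprn_gt0.
  apply: (@le_trans _ _ x); first by rewrite le_max lexx orbT.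
  move: jx; rewrite exprVn ltr_pdivlMr// mulrC ltr_pdivrMr ?exprn_gt0//.
  exact: ltW.
rewrite lee_fin le_eqVlt; apply/orP; left; apply/eqP.
rewrite powRM ?invr_ge0 ?(ltW r0)// exprMn powRD; last first.
  by apply/implyP => _; rewrite gt_eqF.
rewrite powR_mulrn ?(ltW r0)//; ring.
Qed.

Lemma le_integral_max_powR n (p r rho : R) : p <= 0 -> 0 < r <= rho ->
  ((rho `^ p * (2 * rho) ^+ n)%:E <=
   \int[lam n]_w (Num.max r `|w| `^ p)%:E)%E.
Proof.
move=> p0 /andP[r0 rrho].
have rho0 := lt_le_trans r0 rrho.
apply: (@le_trans _ _ (\int[lam n]_w ((rho `^ p)%:E * (\1_(cube rho) w)%:E))%E).
  rewrite ge0_integralZl//; last 2 first.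
  - by apply/measurable_EFinP; apply: measurable_indic; exact: measurable_cube.
  - by rewrite lee_fin powR_ge0.
  rewrite integral_indic ?setIT//; last exact: measurable_cube.
  by rewrite [X in (_ <= _ * X)%E]lebesgue_rV_cube ?(ltW rho0).
apply: ge0_le_integral => //.
- by move=> w _; rewrite mule_ge0// lee_fin powR_ge0.
- apply: measurable_funeM; apply/measurable_EFinP.
  by apply: measurable_indic; exact: measurable_cube.
- apply/measurable_EFinP; apply: (measurableT_comp (measurable_powR p)).
  by apply: measurable_maxr => //; exact: measurable_norm_rV.
move=> w _; rewrite indicE; case: (boolP (w \in _)) => [/set_mem wr|_].
  rewrite mule1 lee_fin; apply: le0_ger_powR => //.
    by rewrite lt_max r0.
  by rewrite ge_max rrho.
by rewrite mule0 lee_fin powR_ge0.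
Qed.

(** Dimension 0 must be excluded: there Lebesgue measure is the Dirac mass at the origin. *)
Lemma ae_neq0_rV m : (0 < m)%N -> \forall x \ae lam m, x != 0.
Proof.
move=> m0; exists [set 0]; split.
- by rewrite -cube0; exact: measurable_cube.
- exact: lebesgue_rV_set1.
- by move=> x /= /negP; rewrite negbK => /eqP.
Qed.

End power_integrals.

(** * Riesz energies under isometric embeddings *)

Section riesz_energy.
Context {R : realType}.
Local Notation lam m := (@lebesgue_rV R m).

(** For theta > 0 this is [energy] before the outer power theta, written for a general density
    [psi]. *)
Definition riesz_energy m (psi : 'rV[R]_m -> R) (e : R) : \bar R :=
  (\int[lam m]_z (psi z * enorm z `^ (e - m%:R))%:E)%E.

Lemma measurable_riesz m (psi : 'rV[R]_m -> R) p :
  measurable_fun setT (psi : _ -> measurableTypeR R) ->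
  measurable_fun setT (fun z => (psi z * enorm z `^ p)%:E).
Proof.
move=> mpsi; apply/measurable_EFinP; apply: measurable_funM => //.
exact: measurable_enorm_powR.
Qed.

(** Where |z| >= 1, lowering the exponent lowers the integrand. Where |z| < 1, the integrand is at
    most T |z|^(e' - m), which is integrable because e' > 0. *)
Lemma riesz_energy_lty_le m (psi : 'rV[R]_m -> R) (T e e' : R) : (0 < m)%N ->
  measurable_fun setT (psi : _ -> measurableTypeR R) ->
  (forall z, 0 <= psi z <= T) -> 0 < e' <= e ->
  (riesz_energy psi e < +oo)%E -> (riesz_energy psi e' < +oo)%E.
Proof.
move=> m0 mpsi psiT /andP[e'0 e'e] efin.
have psi0 z : 0 <= psi z by case/andP: (psiT z).
have T0 : 0 <= T by case/andP: (psiT 0) => /le_trans; apply.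
(* The cap -1/2 makes the exponent negative, as the integrability lemma requires; a smaller exponent
   only enlarges powers of |z| < 1, and -1/2 > -m since m >= 1. *)
pose p := Num.min (e' - m%:R) (- 2^-1).
pose g (z : 'rV[R]_m) := enorm z `^ p * \1_(cube 1) z.
have mg : measurable_fun setT (fun z => (g z)%:E).
  apply/measurable_EFinP; apply: measurable_funM; first exact: measurable_enorm_powR.
  by apply: measurable_indic; exact: measurable_cube.
have g0 z : 0 <= g z by rewrite mulr_ge0// powR_ge0.
have gfin : (\int[lam m]_z (g z)%:E < +oo)%E.
  apply: integral_enorm_powR_cube1_lty; rewrite /p lt_min gt_min.
  have : 1 <= m%:R :> R by rewrite ler1n.
  by move=> ?; apply/andP; split; [apply/andP; split; lra|apply/orP; right; lra].
apply: (@le_lt_trans _ _ (riesz_energy psi e + T%:E * \int[lam m]_z (g z)%:E)%E).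
  rewrite -ge0_integralZl//; last by move=> z _; rewrite lee_fin.
  rewrite -ge0_integralD//.
  - apply: ae_ge0_le_integral => //.
    + by move=> z _; rewrite lee_fin mulr_ge0 ?powR_ge0.
    + exact: measurable_riesz.
    + move=> z _; rewrite -EFinM -EFinD lee_fin addr_ge0// mulr_ge0 ?powR_ge0//.
    + apply: emeasurable_funD; first exact: measurable_riesz.
      exact: measurable_funeM.
    + apply: filterS (@ae_neq0_rV R m m0) => z z0 _.
      rewrite -EFinM -EFinD lee_fin.
      have ez := enorm_gt0 z0.
      have [z1|z1] := leP 1 (enorm z).
        apply: ler_wpDr; first by rewrite mulr_ge0.
        by rewrite ler_wpM2l// ler_powR// lerD2r.
      apply: ler_wpDl; first by rewrite mulr_ge0// powR_ge0.
      apply: ler_pM => //; first exact: powR_ge0.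
        by case/andP: (psiT z).
      rewrite /g indicE mem_set ?mulr1.
        by rewrite ger_powR ?ez ?(ltW z1)// /p ge_min lexx.
      by rewrite /cube/= (le_trans (norm_le_enorm z))// ltW.
  - by move=> z _; rewrite lee_fin mulr_ge0 ?powR_ge0.
  - exact: measurable_riesz.
  - by move=> z _; rewrite -EFinM lee_fin mulr_ge0.
  - exact: measurable_funeM.
apply: lte_add_pinfty => //.
by apply: lte_mul_pinfty => //.
Qed.

Lemma orthonormal_complement k d (M : 'M[R]_(k, d)) : M *m M^T = 1%:M ->
  exists n (N : 'M[R]_(n, d)) (N' : 'M[R]_(d, n)),
  (k + n)%N = d /\ [/\ N *m N' = 1%:M, N *m M^T = 0, M *m N' = 0 &
    M^T *m M + N' *m N = 1%:M].
Proof.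
move=> MM; pose K := kermx M^T.
(* [N'] projects onto the kernel of M^T along the row space of M, then takes coordinates in the
   chosen basis. That basis need not be orthonormal, hence comparability constants for |w N|
   later. *)
exists (\rank K), (row_base K), ((1%:M - M^T *m M) *m pinvmx (row_base K)).
have KM : row_base K *m M^T = 0.
  by apply: sub_kermxP; rewrite eq_row_base.
split.
  rewrite mxrank_ker mxrank_tr (_ : \rank M = k).
    rewrite subnKC//; have := rank_leq_col M; rewrite (_ : \rank M = k)//.
    by apply/eqP/row_freeP; exists M^T.
  by apply/eqP/row_freeP; exists M^T.
split => //.
- have e : row_base K *m (1%:M - M^T *m M) = row_base K.
    by rewrite mulmxBr mulmx1 mulmxA KM mul0mx subr0.
  rewrite mulmxA e mulmxVp//.
  exact: row_base_free.
- have e : M *m (1%:M - M^T *m M) = 0.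
    by rewrite mulmxBr mulmx1 mulmxA MM mul1mx subrr.
  by rewrite mulmxA e mul0mx.
- rewrite mulmxKpV; first by rewrite addrC subrK.
  rewrite eq_row_base; apply/sub_kermxP.
  by rewrite mulmxBl mul1mx -mulmxA MM mulmx1 subrr.
Qed.

Section slicing.
Variables (k n d : nat) (M : 'M[R]_(k, d)) (N : 'M[R]_(n, d)) (N' : 'M[R]_(d, n)).
Hypotheses (MM : M *m M^T = 1%:M) (NN : N *m N' = 1%:M).
Hypotheses (NM : N *m M^T = 0) (MN : M *m N' = 0).
Hypothesis (MMNN : M^T *m M + N' *m N = 1%:M).
Hypothesis knd : (k + n)%N = d.

Lemma enorm_row_sum u w :
  enorm (row_sum M N (u, w)) ^+ 2 = enorm u ^+ 2 + enorm (w *m N) ^+ 2.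
Proof.
have uw : dotp (u *m M) (w *m N) = 0.
  by rewrite dotp_mulmx -mulmxA NM mulmx0 dotpC dotp0l.
rewrite /row_sum !enorm_sqr/= dotpDl ![dotp _ (_ + _)]dotpC !dotpDl uw dotpC uw.
by rewrite addr0 add0r dotp_mulmx -mulmxA MM mulmx1.
Qed.

(** By Pythagoras |u M + w N|^2 = |u|^2 + |w N|^2, and |w N| is comparable to the sup norm of w: [A]
    bounds N from above, and [B] bounds w = (w N) N'. The sup norm on w lets the fiber integrals run
    over cubes. *)
Lemma enorm_row_sum_max : exists c C : R, [/\ 0 < c, 0 < C & forall u w,
  c * Num.max (enorm u) `|w| <= enorm (row_sum M N (u, w)) <=
  C * Num.max (enorm u) `|w|].
Proof.
have [A A0 hA] := mulmx_rV_bounded N.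
have [B B0 hB] := mulmx_rV_bounded N'.
exists (Num.min 1 B^-1), (1 + d%:R * A); split.
- by rewrite lt_min ltr01 invr_gt0.
- by rewrite ltr_pwDl// mulr_ge0// ltW.
move=> u w; have E := enorm_row_sum u w.
have sq (a b : R) : 0 <= a -> 0 <= b -> (a <= b) = (a ^+ 2 <= b ^+ 2).
  by move=> a0 b0; rewrite ler_sqr.
set x := Num.max _ _.
have x0 : 0 <= x by rewrite le_max enorm_ge0.
have ux : enorm u <= x by rewrite le_max lexx.
have wx : `|w| <= x by rewrite le_max lexx orbT.
have c1 : Num.min 1 B^-1 <= 1 by rewrite ge_min lexx.
have cB : Num.min 1 B^-1 <= B^-1 by rewrite ge_min lexx orbT.
have c0 : 0 <= Num.min 1 B^-1 by rewrite le_min ler01 invr_ge0 ltW.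
apply/andP; split.
  have uE : enorm u <= enorm (row_sum M N (u, w)).
    by rewrite sq ?enorm_ge0// E lerDl sqr_ge0.
  have wE : enorm (w *m N) <= enorm (row_sum M N (u, w)).
    by rewrite sq ?enorm_ge0// E lerDr sqr_ge0.
  rewrite /x; case: (leP (enorm u) `|w|) => _.
    apply: le_trans wE; apply: le_trans (norm_le_enorm _).
    apply: (@le_trans _ _ (B^-1 * `|w|)); first by rewrite ler_wpM2r.
    rewrite mulrC ler_pdivrMr// mulrC.
    by rewrite -{1}[w]mulmx1 -NN mulmxA; exact: hB.
  by apply: le_trans uE; rewrite ler_piMl ?enorm_ge0.
have wN : enorm (w *m N) <= d%:R * A * x.
  apply: (le_trans (enorm_le_norm _)); rewrite -mulrA ler_wpM2l//.
  by apply: (le_trans (hA _)); rewrite ler_pM2l.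
apply: (@le_trans _ _ (enorm u + enorm (w *m N))).
  rewrite sq ?addr_ge0 ?enorm_ge0// E sqrrD.
  by rewrite addrAC lerDl mulrn_wge0// mulr_ge0 ?enorm_ge0.
by rewrite mulrDl mul1r lerD.
Qed.

Definition fiber_integral (p : R) (u : 'rV[R]_k) : \bar R :=
  (\int[lam n]_w (enorm (row_sum M N (u, w)) `^ p)%:E)%E.

Lemma measurable_enorm_row_sum p :
  measurable_fun setT (fun x => (enorm (row_sum M N x) `^ p) : measurableTypeR R).
Proof.
apply: (measurableT_comp (measurable_enorm_powR p)).
exact: measurable_row_sum.
Qed.

Lemma measurable_fiber_integral p : measurable_fun setT (fiber_integral p).
Proof.
apply: (@measurable_fun_fubini_tonelli_F _ _ _ _ _ (lam n)
  (fun x => (enorm (row_sum M N x) `^ p)%:E)).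
  by apply/measurable_EFinP; exact: measurable_enorm_row_sum.
by move=> x; rewrite lee_fin powR_ge0.
Qed.

(** In the coordinates (u, w) one has z M^T = u, so psi is constant along fibers and leaves the
    inner integral of Tonelli's formula. *)
Lemma riesz_energy_slice : exists2 c : R, 0 < c &
  forall (psi : 'rV[R]_k -> R) e,
  measurable_fun setT (psi : _ -> measurableTypeR R) -> (forall u, 0 <= psi u) ->
  (c%:E * riesz_energy (fun z : 'rV[R]_d => psi (z *m M^T)) e =
   \int[lam k]_u ((psi u)%:E * fiber_integral (e - d%:R) u))%E.
Proof.
have [c c0 hc] := pushforward_row_sum MM NN NM MN MMNN.
exists c => // psi e mpsi psi0; rewrite /riesz_energy.
set F := fun z => _%:E.
have mF : measurable_fun setT F.
  apply: measurable_riesz.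
  by apply: (measurableT_comp mpsi); exact: measurable_mulmx_rV.
have F0 z : (0 <= F z)%E by rewrite lee_fin mulr_ge0// powR_ge0.
have c0' : 0 <= c by exact: ltW.
rewrite -[c%:E]/((NngNum c0')%:num%:E) -ge0_integral_mscale//;
  last by move=> z _; exact: F0.
transitivity (\int[pushforward (lam k \x lam n)%E (row_sum M N)]_z F z)%E.
  apply/esym; apply: (@eq_measure_integral _ _ _ _
    (mscale (NngNum c0') (lam d))
    (measure_function_pushforward__canonical__measure_function_Measure
      (lam k \x lam n)%E (@measurable_row_sum R k n d M N))) => A mA _.
  by rewrite /= hc.
rewrite (ge0_integral_pushforward (@measurable_row_sum R k n d M N))//.
rewrite preimage_setT (@fubini_tonelli1 _ _ _ _ _ (lam k) (lam n)); last 2 first.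
- exact: (measurableT_comp mF (@measurable_row_sum R k n d M N)).
- by move=> p; exact: F0.
apply: eq_integral => u _; rewrite /fubini_F/= -ge0_integralZl//; last 3 first.
- apply/measurable_EFinP.
  exact: (measurableT_comp (measurable_enorm_row_sum _) (pair1_measurable u)).
- by move=> w _; rewrite lee_fin powR_ge0.
- by rewrite lee_fin.
apply: eq_integral => w _.
by rewrite /F /row_sum/= mulmxDl -!mulmxA MM NM mulmx1 mulmx0 addr0.
Qed.

End slicing.
End riesz_energy.

Lemma lte_pmull_pinfty (R : realType) (c : R) (x : \bar R) :
  0 < c -> (0 <= x)%E -> (c%:E * x < +oo)%E = (x < +oo)%E.
Proof.
move=> c0; case: x => [r||]// _; first by rewrite -EFinM !ltry.
by rewrite gt0_muley ?lte_fin.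
Qed.

Section slicing_bounds.
Context {R : realType}.
Local Notation lam m := (@lebesgue_rV R m).
Variables (k n d : nat) (M : 'M[R]_(k, d)) (N : 'M[R]_(n, d)) (N' : 'M[R]_(d, n)).
Hypotheses (MM : M *m M^T = 1%:M) (NN : N *m N' = 1%:M) (NM : N *m M^T = 0).
Local Notation fiber := (fiber_integral M N).

Lemma measurable_max_powR p r :
  measurable_fun setT (fun w : 'rV[R]_n => (Num.max r `|w| `^ p)%:E).
Proof.
apply/measurable_EFinP; apply: (measurableT_comp (measurable_powR p)).
by apply: measurable_maxr => //; exact: measurable_norm_rV.
Qed.

Lemma measurable_enorm_row_sum_r p u :
  measurable_fun setT (fun w => (enorm (row_sum M N (u, w)) `^ p)%:E).
Proof.
apply/measurable_EFinP.
exact: (measurableT_comp (measurable_enorm_row_sum _ _ _) (pair1_measurable u)).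
Qed.

(** The condition p < -n is convergence at infinity in R^n; for p = e - d it reads e < k. *)
Lemma fiber_integral_le p : p < - n%:R -> exists2 C : R, 0 < C & forall u, u != 0 ->
  (fiber p u <= (C * enorm u `^ (p + n%:R))%:E)%E.
Proof.
move=> pn; have p0 : p <= 0 by rewrite ltW// (lt_le_trans pn)// oppr_le0.
have [c [c' [c0 _ hc]]] := enorm_row_sum_max MM NN NM.
have [C C0 hC] := integral_max_powR_le pn.
exists (c `^ p * C); first by rewrite mulr_gt0// powR_gt0.
move=> u /enorm_gt0 u0; rewrite -mulrA EFinM.
apply: (@le_trans _ _ ((c `^ p)%:E * \int[lam n]_w (Num.max (enorm u) `|w| `^ p)%:E)%E);
  last by rewrite lee_wpmul2l ?lee_fin ?powR_ge0// hC.
rewrite -ge0_integralZl//; last 3 first.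
- exact: measurable_max_powR.
- by move=> w _; rewrite lee_fin powR_ge0.
- by rewrite lee_fin powR_ge0.
apply: ge0_le_integral => //.
- by move=> w _; rewrite lee_fin powR_ge0.
- exact: measurable_enorm_row_sum_r.
- by apply: measurable_funeM; exact: measurable_max_powR.
move=> w _; rewrite -EFinM lee_fin.
have x0 : 0 < Num.max (enorm u) `|w| by rewrite lt_max u0.
rewrite -powRM ?(ltW c0) ?(ltW x0)//.
by apply: le0_ger_powR => //; [exact: mulr_gt0|case/andP: (hc u w)].
Qed.

(** The radius [rho] stays free: rho = |u| gives the bound matching [fiber_integral_le], and rho
    tending to infinity gives divergence when p + n > 0. *)
Lemma fiber_integral_ge p : p <= 0 -> exists2 c : R, 0 < c & forall u rho,
  u != 0 -> enorm u <= rho -> ((c * rho `^ (p + n%:R))%:E <= fiber p u)%E.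
Proof.
move=> p0; have [c [C [c0 C0 hC]]] := enorm_row_sum_max MM NN NM.
exists (C `^ p * 2 ^+ n); first by rewrite mulr_gt0// ?powR_gt0// exprn_gt0.
move=> u rho /enorm_gt0 u0 urho.
have rho0 := lt_le_trans u0 urho.
apply: (@le_trans _ _ ((C `^ p)%:E * \int[lam n]_w (Num.max (enorm u) `|w| `^ p)%:E)%E).
  have -> : C `^ p * 2 ^+ n * rho `^ (p + n%:R) = C `^ p * (rho `^ p * (2 * rho) ^+ n).
    rewrite exprMn powRD; last by apply/implyP => _; rewrite gt_eqF.
    by rewrite powR_mulrn ?(ltW rho0)//; ring.
  rewrite EFinM lee_wpmul2l ?lee_fin ?powR_ge0//.
  by apply: le_integral_max_powR => //; rewrite u0.
rewrite -ge0_integralZl//; last 3 first.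
- exact: measurable_max_powR.
- by move=> w _; rewrite lee_fin powR_ge0.
- by rewrite lee_fin powR_ge0.
apply: ge0_le_integral => //.
- by move=> w _; rewrite -EFinM lee_fin mulr_ge0// powR_ge0.
- by apply: measurable_funeM; exact: measurable_max_powR.
- exact: measurable_enorm_row_sum_r.
move=> w _; rewrite -EFinM lee_fin.
have x0 : 0 < Num.max (enorm u) `|w| by rewrite lt_max u0.
have /andP[h1 h2] := hC u w.
rewrite -powRM ?(ltW C0) ?(ltW x0)//.
by apply: le0_ger_powR => //; apply: lt_le_trans h1; exact: mulr_gt0.
Qed.

End slicing_bounds.

Section riesz_energy_isometry.
Context {R : realType}.
Local Notation lam m := (@lebesgue_rV R m).
Variables (k d : nat) (M : 'M[R]_(k, d)) (psi : 'rV[R]_k -> R).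
Hypotheses (MM : M *m M^T = 1%:M) (k0 : (0 < k)%N).
Hypotheses (mpsi : measurable_fun setT (psi : _ -> measurableTypeR R)).
Hypothesis psi0 : forall u, 0 <= psi u.

Lemma riesz_energy_isometry e : e < k%:R ->
  (riesz_energy (fun z : 'rV[R]_d => psi (z *m M^T)) e < +oo)%E <->
  (riesz_energy psi e < +oo)%E.
Proof.
move=> ek; have [n [N [N' [knd [NN NM MN MMNN]]]]] := orthonormal_complement MM.
have [a a0 /(_ psi e mpsi psi0) slice] := riesz_energy_slice MM NN NM MN MMNN.
have dE : e - d%:R + n%:R = e - k%:R by rewrite -knd natrD; ring.
have mf : measurable_fun setT
    (fun u => ((psi u)%:E * fiber_integral M N (e - d%:R) u)%E).
  apply: emeasurable_funM; first exact/measurable_EFinP.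
  exact: measurable_fiber_integral.
have fiber0 u : (0 <= fiber_integral M N (e - d%:R) u)%E.
  by apply: integral_ge0 => w _; rewrite lee_fin powR_ge0.
have energy0 m (phi : 'rV[R]_m -> R) : (forall u, 0 <= phi u) ->
    (0 <= riesz_energy phi e)%E.
  by move=> phi0; apply: integral_ge0 => z _; rewrite lee_fin mulr_ge0// powR_ge0.
have sliceE : (riesz_energy (fun z : 'rV[R]_d => psi (z *m M^T)) e < +oo)%E <->
    (\int[lam k]_u ((psi u)%:E * fiber_integral M N (e - d%:R) u) < +oo)%E.
  by rewrite -slice lte_pmull_pinfty// energy0.
have [|C C0 hC] := @fiber_integral_le R k n d M N N' MM NN NM (e - d%:R).
  by rewrite ltrBlDr addrC -knd natrD addrK.
have [|c c0 hc] := @fiber_integral_ge R k n d M N N' MM NN NM (e - d%:R).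
  by rewrite subr_le0 (le_trans (ltW ek))// ler_nat -knd leq_addr.
rewrite dE in hC hc; apply: (iff_trans sliceE); split => h.
  suff : (c%:E * riesz_energy psi e < +oo)%E.
    by rewrite lte_pmull_pinfty// energy0.
  rewrite -ge0_integralZl//; last 3 first.
  - exact: measurable_riesz.
  - by move=> u _; rewrite lee_fin mulr_ge0// powR_ge0.
  - by rewrite lee_fin ltW.
  apply: le_lt_trans h; apply: ge0_le_integral => //.
  - by move=> u _; rewrite -EFinM lee_fin mulr_ge0 ?mulr_ge0 ?powR_ge0 ?(ltW c0).
  - by apply: measurable_funeM; exact: measurable_riesz.
  (* At the origin the power is 0 by convention, because e - k is not 0, so the lower bound is
     trivial there. *)
  move=> u _; have [->|u0] := eqVneq u 0.
    by rewrite enorm0 powR0 ?subr_eq0 ?lt_eqF// mulr0 mule0 mule_ge0// lee_fin.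
  rewrite -EFinM mulrCA EFinM lee_wpmul2l ?lee_fin//.
  exact: hc.
apply: (@le_lt_trans _ _ (C%:E * riesz_energy psi e)%E); last first.
  by rewrite lte_pmull_pinfty// energy0.
rewrite -ge0_integralZl//; last 3 first.
- exact: measurable_riesz.
- by move=> u _; rewrite lee_fin mulr_ge0// powR_ge0.
- by rewrite lee_fin ltW.
(* The upper bound can fail at u = 0, where its right side is 0 and the fiber integral may be
   infinite; hence an almost everywhere comparison. *)
apply: ae_ge0_le_integral => //.
- by move=> u _; rewrite mule_ge0// lee_fin.
- by move=> u _; rewrite -EFinM lee_fin mulr_ge0 ?mulr_ge0 ?powR_ge0 ?(ltW C0).
- by apply: measurable_funeM; exact: measurable_riesz.
apply: filterS (@ae_neq0_rV R k k0) => u u0 _.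
rewrite -EFinM mulrCA EFinM lee_wpmul2l ?lee_fin//.
exact: hC.
Qed.

(** Restricting to the cube where psi >= delta bounds the energy below by a constant times rho^(e-k)
    for all large rho. The condition e <= d keeps the exponent e - d of the fiber integrals
    nonpositive. *)
Lemma riesz_energy_isometry_pinfty e delta r : k%:R < e <= d%:R ->
  0 < delta -> 0 < r -> (forall u, cube r u -> delta <= psi u) ->
  riesz_energy (fun z : 'rV[R]_d => psi (z *m M^T)) e = +oo%E.
Proof.
move=> /andP[ke ed] delta0 r0 hpsi.
have [n [N [N' [knd [NN NM MN MMNN]]]]] := orthonormal_complement MM.
have [a a0 /(_ psi e mpsi psi0) slice] := riesz_energy_slice MM NN NM MN MMNN.
have dE : e - d%:R + n%:R = e - k%:R by rewrite -knd natrD; ring.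
have [|c c0 hc] := @fiber_integral_ge R k n d M N N' MM NN NM (e - d%:R).
  by rewrite subr_le0.
rewrite dE in hc.
have ek0 : 0 < e - k%:R by rewrite subr_gt0.
have mf : measurable_fun setT
    (fun u => ((psi u)%:E * fiber_integral M N (e - d%:R) u)%E).
  apply: emeasurable_funM; first exact/measurable_EFinP.
  exact: measurable_fiber_integral.
have fiber0 u : (0 <= fiber_integral M N (e - d%:R) u)%E.
  by apply: integral_ge0 => w _; rewrite lee_fin powR_ge0.
have v0 : 0 < (2 * r) ^+ k by rewrite exprn_gt0// mulr_gt0.
have lower rho : k%:R * r <= rho ->
    ((delta * (c * rho `^ (e - k%:R)) * (2 * r) ^+ k)%:E <=
     a%:E * riesz_energy (fun z : 'rV[R]_d => psi (z *m M^T)) e)%E.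
  move=> rrho; rewrite slice.
  have b0 : 0 <= delta * (c * rho `^ (e - k%:R)).
    by rewrite mulr_ge0 ?(ltW delta0)// mulr_ge0 ?powR_ge0// ltW.
  apply: (@le_trans _ _ (\int[lam k]_u ((delta * (c * rho `^ (e - k%:R)))%:E *
      (\1_(cube r) u)%:E))%E).
    rewrite ge0_integralZl//; last 1 first.
    - by apply/measurable_EFinP; apply: measurable_indic; exact: measurable_cube.
    rewrite integral_indic ?setIT//; last exact: measurable_cube.
    by rewrite [X in (_ <= _ * X)%E]lebesgue_rV_cube ?(ltW r0).
  apply: ae_ge0_le_integral => //.
  - by move=> u _; rewrite mule_ge0// lee_fin.
  - apply: measurable_funeM; apply/measurable_EFinP.
    by apply: measurable_indic; exact: measurable_cube.
  - by move=> u _; rewrite mule_ge0// lee_fin.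
  apply: filterS (@ae_neq0_rV R k k0) => u u0 _.
  rewrite indicE; case: (boolP (u \in _)) => [/set_mem ur|_]; last first.
    by rewrite mule0 mule_ge0// lee_fin.
  rewrite mule1 EFinM; apply: lee_pmul; rewrite ?lee_fin ?(ltW delta0)//.
  - by rewrite mulr_ge0 ?powR_ge0// ltW.
  - exact: hpsi.
  - apply: hc => //; apply: le_trans rrho; apply: (le_trans (enorm_le_norm _)).
    by rewrite ler_wpM2l.
have pos : (0 <= riesz_energy (fun z : 'rV[R]_d => psi (z *m M^T)) e)%E.
  by apply: integral_ge0 => z _; rewrite lee_fin mulr_ge0// powR_ge0.
move: pos lower; case: (riesz_energy _ _) => [x||]// x0 lower.
rewrite lee_fin in x0.
exfalso.
pose b := delta * c * (2 * r) ^+ k.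
have b0 : 0 < b by rewrite mulr_gt0// mulr_gt0.
(* Chosen so that y b = a x + 1; any rho with rho^(e-k) >= y then contradicts the lower bound. *)
pose y := (a * x + 1) / b.
have y0 : 0 < y by rewrite divr_gt0// ltr_wpDl// mulr_ge0// ltW.
pose rho := Num.max (k%:R * r) (y `^ (e - k%:R)^-1).
have /lower : k%:R * r <= rho by rewrite le_max lexx.
rewrite -EFinM lee_fin; apply/negP; rewrite -ltNge.
have : y <= rho `^ (e - k%:R).
  have -> : y = (y `^ (e - k%:R)^-1) `^ (e - k%:R).
    by rewrite -powRrM mulVf ?gt_eqF// powRr1// ltW.
  apply: ge0_ler_powR; rewrite ?nnegrE ?powR_ge0 ?(ltW ek0)//.
    by rewrite le_max powR_ge0 orbT.
  by rewrite le_max lexx orbT.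
rewrite /y ler_pdivrMr// => h.
apply: (@lt_le_trans _ _ (rho `^ (e - k%:R) * b)).
  by apply: lt_le_trans h; rewrite ltrDl.
by rewrite /b le_eqVlt; apply/orP; left; apply/eqP; ring.
Qed.

End riesz_energy_isometry.

(** * Fourier transforms of finite measures *)

Lemma dotp_le (R : realType) m (x y : 'rV[R]_m) :
  `|dotp x y| <= m%:R * `|x| * `|y|.
Proof.
apply: (le_trans (ler_norm_sum _ _ _)).
apply: (@le_trans _ _ (\sum_(i < m) `|x| * `|y|)).
  by apply: ler_sum => i _; rewrite normrM ler_pM// rV_coord_le_norm.
by rewrite sumr_const card_ord -[leLHS]mulr_natl mulrA.
Qed.

Section trigonometric_integrals.
Context {R : realType} {m : nat}.
Variable mu : {finite_measure set 'rV[R]_m -> \bar R}.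
Variable h : R -> R.
Hypotheses (ch : continuous h) (h1 : forall t, `|h t| <= 1).

(** For h = cos and h = sin these are the real and imaginary parts of the Fourier transform. *)
Definition trig_integral (z : 'rV[R]_m) : R :=
  \int[mu]_x h (- (2 * pi * dotp z x)).

Lemma measurable_trig :
  measurable_fun setT (fun p : 'rV[R]_m * 'rV[R]_m =>
    h (- (2 * pi * dotp p.1 p.2)) : measurableTypeR R).
Proof.
apply: (measurableT_comp (continuous_measurable_fun ch)).
apply: measurableT_comp => //; apply: measurable_funM => //.
apply: measurable_sum => i; apply: measurable_funM.
  exact: (measurableT_comp (@measurable_coord_rV R m i) measurable_fst).
exact: (measurableT_comp (@measurable_coord_rV R m i) measurable_snd).
Qed.

Lemma measurable_trig_r (z : 'rV[R]_m) :
  measurable_fun setT (fun x : 'rV[R]_m => h (- (2 * pi * dotp z x)) : measurableTypeR R).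
Proof. exact: (measurableT_comp measurable_trig (pair1_measurable z)). Qed.

Lemma finite_measure_lty : (mu setT < +oo)%E.
Proof. by rewrite -ge0_fin_numE// fin_num_measure. Qed.

Lemma integrable_trig (z : 'rV[R]_m) :
  mu.-integrable setT (EFin \o (fun x => h (- (2 * pi * dotp z x)))).
Proof.
apply: measurable_bounded_integrable => //.
- exact: finite_measure_lty.
- exact: measurable_trig_r.
- exists 1; split => // t t1 x _ /=; exact: le_trans (h1 _) (ltW t1).
Qed.

Lemma integrable_cst1 : mu.-integrable setT (EFin \o (fun=> (1 : R))).
Proof.
apply: measurable_bounded_integrable => //; first exact: finite_measure_lty.
exact: bounded_cst.
Qed.

Lemma measurable_trig_integral :
  measurable_fun setT (trig_integral : _ -> measurableTypeR R).
Proof.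
(* Adding 1 makes the integrand nonnegative, so that Tonelli gives measurability in z; the added
   mass is subtracted afterwards. *)
have E z : trig_integral z =
    fine (\int[mu]_x (1 + h (- (2 * pi * dotp z x)))%:E)%E - fine (mu setT).
  have := RintegralD measurableT integrable_cst1 (integrable_trig z).
  rewrite Rintegral_cst// mul1r /Rintegral => ->.
  by rewrite addrAC subrr add0r.
rewrite (funext E); apply: measurable_funB => //.
apply: (measurableT_comp (@fine_measurable R setT measurableT)).
apply: (@measurable_fun_fubini_tonelli_F _ _ _ _ _ mu
  (fun p => (1 + h (- (2 * pi * dotp p.1 p.2)))%:E)).
  apply/measurable_EFinP; apply: measurable_funD => //; exact: measurable_trig.
move=> p; rewrite lee_fin -lerBlDl sub0r.
by move: (h1 (- (2 * pi * dotp p.1 p.2))); rewrite ler_norml => /andP[].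
Qed.

Lemma trig_integral_le z : `|trig_integral z| <= fine (mu setT).
Proof.
apply: (le_trans (le_normr_Rintegral measurableT (integrable_trig z))).
rewrite -[leRHS]mul1r -Rintegral_cst//; apply: le_Rintegral => //.
- have := integrable_abse (integrable_trig z).
  by apply: eq_integrable.
- exact: integrable_cst1.
Qed.

(** Continuity at 0 by dominated convergence, with the constant 1 as dominating function. The rate
    1/(n+1) fits the sequence built in [fourier_modulus_lower_bound]. *)
Lemma cvg_trig_integral (u : nat -> 'rV[R]_m) :
  (forall n, `|u n| <= n.+1%:R^-1) ->
  trig_integral (u n) @[n --> \oo] --> h 0 * fine (mu setT).
Proof.
move=> hu.
have H : (\int[mu]_x (h (- (2 * pi * dotp (u n) x)))%:E)%E @[n --> \oo] -->
    (\int[mu]_x (h 0)%:E)%E.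
  have [] // := @dominated_convergence _ _ _ mu setT measurableT
    (fun n x => (h (- (2 * pi * dotp (u n) x)))%:E) (fun=> (h 0)%:E) (fun=> 1%:E).
  - by move=> n; apply/measurable_EFinP; exact: measurable_trig_r.
  - apply: aeW => x _; apply: cvg_EFin; first by near=> n.
    apply: (@cvg_comp _ _ _ (fun n => - (2 * pi * dotp (u n) x)) h _ (nbhs 0));
      last exact: ch.
    apply: norm_cvg0.
    apply: (@squeeze_cvgr _ _ _ _ (fun=> 0)
      (fun n => 2 * pi * (m%:R * `|x|) * harmonic n)).
    + near=> n; rewrite normr_ge0/= normrN normrM ger0_norm; last first.
        by rewrite mulr_ge0// pi_ge0.
      rewrite -[leRHS]mulrA ler_pM2l ?mulr_gt0// ?pi_gt0//.
      apply: (le_trans (dotp_le _ _)).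
      by rewrite [leLHS]mulrAC ler_wpM2l ?mulr_ge0//; exact: hu.
    + exact: cvg_cst.
    + rewrite -[X in _ --> X](mulr0 (2 * pi * (m%:R * `|x|))).
      by apply: cvgM; [exact: cvg_cst|exact: cvg_harmonic].
  - exact: integrable_cst1.
  - by apply: aeW => x n _; rewrite lee_fin.
have E : (\int[mu]_x (h 0)%:E)%E = (h 0 * fine (mu setT))%:E.
  by rewrite integral_cst// EFinM fineK// fin_num_measure.
rewrite E in H.
exact: fine_cvg H.
Unshelve. all: by end_near. Qed.

End trigonometric_integrals.

Section fourier_modulus_theory.
Context {R : realType} {m : nat}.

Lemma fourier_modulusE (mu : {finite_measure set 'rV[R]_m -> \bar R}) z :
  fourier_modulus mu z =
  Num.sqrt (trig_integral mu cos z ^+ 2 + trig_integral mu sin z ^+ 2).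
Proof. by []. Qed.

(** Measures reconstructed below agree only on Borel sets, so they cannot simply be rewritten as set
    functions. *)
Lemma eq_fourier_modulus (mu nu : {measure set 'rV[R]_m -> \bar R}) z :
  (forall A, measurable A -> mu A = nu A) ->
  fourier_modulus mu z = fourier_modulus nu z.
Proof.
move=> munu; rewrite /fourier_modulus /fourier_transform /cintegral.
by congr (ComplexField.Normc.normc (Complex (fine _) (fine _)));
  apply: eq_measure_integral => A mA _; exact: munu.
Qed.

Variable mu : {finite_measure set 'rV[R]_m -> \bar R}.

Lemma normr_cos_le1 (t : R) : `|cos t| <= 1.
Proof. by rewrite ler_norml cos_geN1 cos_le1. Qed.

Lemma normr_sin_le1 (t : R) : `|sin t| <= 1.
Proof. by rewrite ler_norml sin_geN1 sin_le1. Qed.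

Lemma fourier_modulus_ge0 z : 0 <= fourier_modulus mu z.
Proof. by rewrite fourier_modulusE sqrtr_ge0. Qed.

Lemma measurable_fourier_modulus :
  measurable_fun setT (fourier_modulus mu : _ -> measurableTypeR R).
Proof.
have E z : fourier_modulus mu z =
    (trig_integral mu cos z ^+ 2 + trig_integral mu sin z ^+ 2) `^ 2^-1.
  by rewrite fourier_modulusE powR12_sqrt// addr_ge0// sqr_ge0.
rewrite (funext E); apply: (measurableT_comp (measurable_powR 2^-1)).
by apply: measurable_funD; apply: measurable_funX; apply: measurable_trig_integral;
  (exact: continuous_cos || exact: continuous_sin ||
   exact: normr_cos_le1 || exact: normr_sin_le1).
Qed.

Lemma fourier_modulus_le z : fourier_modulus mu z <= 2 * fine (mu setT).
Proof.
have T0 : 0 <= fine (mu setT) by exact: fine_ge0.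
have hc := trig_integral_le mu (@continuous_cos R) normr_cos_le1 z.
have hs := trig_integral_le mu (@continuous_sin R) normr_sin_le1 z.
rewrite -ler_sqr ?nnegrE ?fourier_modulus_ge0 ?mulr_ge0// fourier_modulusE.
rewrite sqr_sqrtr ?addr_ge0 ?sqr_ge0//.
have hc2 : trig_integral mu cos z ^+ 2 <= fine (mu setT) ^+ 2.
  by rewrite -[leLHS]ger0_norm ?sqr_ge0// normrX lerXn2r ?nnegrE.
have hs2 : trig_integral mu sin z ^+ 2 <= fine (mu setT) ^+ 2.
  by rewrite -[leLHS]ger0_norm ?sqr_ge0// normrX lerXn2r ?nnegrE.
rewrite exprMn; have := sqr_ge0 (fine (mu setT)); nra.
Qed.

(** At 0 the transform equals the total mass T > 0, so by continuity its modulus stays above T/2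
    nearby. Otherwise points u_n tending to 0 would violate this. *)
Lemma fourier_modulus_lower_bound : mu setT <> 0%E -> exists delta r : R,
  [/\ 0 < delta, 0 < r & forall u, cube r u -> delta <= fourier_modulus mu u].
Proof.
move=> mu0; pose T := fine (mu setT).
have T0 : 0 < T.
  rewrite fine_gt0// lt0e measure_ge0 andbT (finite_measure_lty mu) andbT.
  exact/eqP.
exists (T / 2); apply: contrapT => /forallNP H.
have /choice[u hu] n : exists u : 'rV[R]_m,
    `|u| <= n.+1%:R^-1 /\ fourier_modulus mu u < T / 2.
  have /existsNP[u /not_implyP[h1 /negP]] : ~ forall u, cube n.+1%:R^-1 u ->
      T / 2 <= fourier_modulus mu u.
    by move=> h; apply: (H n.+1%:R^-1); split => //; rewrite divr_gt0.
  by rewrite -ltNge; exists u.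
have := @cvg_trig_integral R m mu cos (@continuous_cos R) normr_cos_le1 u
  (fun n => (hu n).1).
rewrite cos0 mul1r -/T => /cvgrPdist_lt /(_ (T / 2)).
rewrite divr_gt0// => /(_ isT)[n _ /(_ n (leqnn n))]/= h.
have := (hu n).2; apply/negP; rewrite -leNgt.
(* The modulus dominates the real part, which alone converges to T. *)
apply: (@le_trans _ _ (trig_integral mu cos (u n))).
  by move: h; rewrite ltr_norml => /andP[_]; lra.
rewrite fourier_modulusE (le_trans (ler_norm _))// -sqrtr_sqr ler_sqrt.
  by rewrite lerDl sqr_ge0.
by rewrite addr_ge0// sqr_ge0.
Qed.

Lemma measurable_affine_rV d (b : 'rV[R]_d) (M : 'M[R]_(m, d)) :
  measurable_fun setT (fun x : 'rV[R]_m => b + x *m M).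
Proof.
rewrite (_ : (fun x => _) = (fun x : 'rV[R]_d => x + b) \o (fun x => x *m M)).
  by apply: measurableT_comp; [exact: measurable_addr_rV|exact: measurable_mulmx_rV].
by apply/funext => x /=; rewrite addrC.
Qed.

(** The translation by [b] only multiplies the transform by a phase of modulus 1; the addition
    formulas for cos and sin express this in real terms. *)
Lemma fourier_modulus_pushforward_affine d (b : 'rV[R]_d) (M : 'M[R]_(m, d)) z :
  fourier_modulus (pushforward mu (fun x => b + x *m M)) z =
  fourier_modulus mu (z *m M^T).
Proof.
pose f (x : 'rV[R]_m) := b + x *m M.
pose al := 2 * pi * dotp z b.
pose be x := - (2 * pi * dotp (z *m M^T) x).
have angle x : - (2 * pi * dotp z (f x)) = - al + be x.
  rewrite /f dotpC dotpDl dotp_mulmx dotpC [dotp x _]dotpC /be /al mulrDr.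
  by rewrite opprD.
have pf (h : R -> R) : continuous h -> (forall t, `|h t| <= 1) ->
    fine (\int[pushforward mu f]_x (h (- (2 * pi * dotp z x)))%:E)%E =
    \int[mu]_x h (- al + be x).
  move=> ch h1; rewrite /Rintegral; congr fine.
  rewrite (integral_pushforward (@measurable_affine_rV d b M)) ?preimage_setT//.
  - by apply: eq_integral => x _ /=; rewrite angle.
  - by apply/measurable_EFinP; exact: measurable_trig_r.
  - apply: measurable_bounded_integrable => //.
    + exact: finite_measure_lty.
    + apply: (measurableT_comp (measurable_trig_r ch z)).
      exact: measurable_affine_rV.
    + by exists 1; split => // t t1 x _ /=; exact: le_trans (h1 _) (ltW t1).
have ic c : mu.-integrable setT (EFin \o (fun x => c * cos (be x))).
  exact: integrableZl (integrable_trig mu (@continuous_cos R) normr_cos_le1 _).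
have isn c : mu.-integrable setT (EFin \o (fun x => c * sin (be x))).
  exact: integrableZl (integrable_trig mu (@continuous_sin R) normr_sin_le1 _).
have Zc c : \int[mu]_x (c * cos (be x)) = c * trig_integral mu cos (z *m M^T).
  by rewrite RintegralZl//; exact: (integrable_trig mu (@continuous_cos R) normr_cos_le1).
have Zs c : \int[mu]_x (c * sin (be x)) = c * trig_integral mu sin (z *m M^T).
  by rewrite RintegralZl//; exact: (integrable_trig mu (@continuous_sin R) normr_sin_le1).
have cE : fine (\int[pushforward mu f]_x (cos (- (2 * pi * dotp z x)))%:E)%E =
    cos (- al) * trig_integral mu cos (z *m M^T) -
    sin (- al) * trig_integral mu sin (z *m M^T).
  rewrite pf; [|exact: continuous_cos|exact: normr_cos_le1].
  under eq_Rintegral do rewrite cosD.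
  by rewrite RintegralB// Zc Zs.
have sE : fine (\int[pushforward mu f]_x (sin (- (2 * pi * dotp z x)))%:E)%E =
    sin (- al) * trig_integral mu cos (z *m M^T) +
    cos (- al) * trig_integral mu sin (z *m M^T).
  rewrite pf; [|exact: continuous_sin|exact: normr_sin_le1].
  under eq_Rintegral do rewrite sinD.
  by rewrite RintegralD// Zc Zs.
rewrite fourier_modulusE.
transitivity (Num.sqrt (fine (\int[pushforward mu f]_x (cos (- (2 * pi * dotp z x)))%:E)%E ^+ 2 +
  fine (\int[pushforward mu f]_x (sin (- (2 * pi * dotp z x)))%:E)%E ^+ 2)) => //.
rewrite cE sE; congr Num.sqrt.
have := cos2Dsin2 (- al).
set c := cos _; set s := sin _; move=> cs.
rewrite -[RHS]mul1r -cs; ring.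
Qed.

End fourier_modulus_theory.

(** * Fourier dimension *)

Section dimension.
Context {R : realType}.

Lemma energy_lty m theta s (nu : set 'rV[R]_m -> \bar R) : 0 < theta ->
  (energy s theta nu < +oo)%E <->
  (riesz_energy (fun z => fourier_modulus nu z `^ (2 / theta))%R (s / theta)%R
    < +oo)%E.
Proof.
move=> theta0; rewrite /energy gt_eqF//; split; last exact: poweR_lty.
by apply: lty_poweRy; rewrite gt_eqF.
Qed.

Lemma dimF_ge0 m theta (nu : set 'rV[R]_m -> \bar R) : (0 <= dimF theta nu)%E.
Proof. by apply: ereal_sup_ubound; left. Qed.

Lemma le_dimF m theta s (nu : set 'rV[R]_m -> \bar R) : 0 <= s ->
  (energy s theta nu < +oo)%E -> (s%:E <= dimF theta nu)%E.
Proof. by move=> s0 h; apply: ereal_sup_ubound; right; exists s. Qed.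

(** Since x >= 0, the adjoined 0 and s = 0 are harmless; monotonicity of energies is available for
    positive exponents only. *)
Lemma dimF_leP m theta (nu : set 'rV[R]_m -> \bar R) (x : \bar R) : (0 <= x)%E ->
  (forall s, 0 < s -> (energy s theta nu < +oo)%E -> (s%:E <= x)%E) ->
  (dimF theta nu <= x)%E.
Proof.
move=> x0 h; apply: ge_ereal_sup => _ [->//|[s [s0 es] <-]].
by have [<-//|sn0] := eqVneq 0 s; apply: h => //; rewrite lt_neqAle sn0.
Qed.

Lemma eq_dimF m theta (nu1 nu2 : set 'rV[R]_m -> \bar R) :
  (forall z, fourier_modulus nu1 z = fourier_modulus nu2 z) ->
  dimF theta nu1 = dimF theta nu2.
Proof.
by move=> h; rewrite /dimF /energy (funext h).
Qed.

Variables (k d : nat) (M : 'M[R]_(k, d)).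
Variables (mu : {finite_measure set 'rV[R]_k -> \bar R}) (nu : set 'rV[R]_d -> \bar R).
Hypotheses (k0 : (0 < k)%N) (kd : (k < d)%N) (MM : M *m M^T = 1%:M).
Hypotheses (mu0 : mu setT <> 0%E).
Hypothesis nuE : forall z, fourier_modulus nu z = fourier_modulus mu (z *m M^T).

Lemma dimF0_isometry : dimF 0 nu = 0%E.
Proof.
apply/eqP; rewrite eq_le dimF_ge0 andbT; apply: dimF_leP => // s s0.
rewrite /energy eqxx => es; exfalso.
have [n [N [N' [knd [NN NM _ _]]]]] := orthonormal_complement MM.
have [delta [r [delta0 r0 hdelta]]] := fourier_modulus_lower_bound mu0.
have n0 : (0 < n)%N by rewrite -(ltn_add2l k) addn0 knd.
(* A nonzero vector of the kernel of M^T, which exists because k < d. *)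
pose z : 'rV[R]_d := row (Ordinal n0) N.
have zM : z *m M^T = 0 by rewrite -row_mul NM row0.
have z0 : z != 0.
  apply/eqP => zN; have /(congr1 (fun A : 'rV[R]_n => A ord0 (Ordinal n0))) : z *m N' = 0.
    by rewrite zN mul0mx.
  by rewrite -row_mul NN !mxE eqxx; apply/eqP; rewrite oner_eq0.
have ez0 := enorm_gt0 z0.
pose E := ereal_sup (range (fun z => (fourier_modulus nu z ^+ 2 * enorm z `^ s)%:E)).
have leE y : ((fourier_modulus nu y ^+ 2 * enorm y `^ s)%:E <= E)%E.
  by apply: ereal_sup_ubound; exists y.
have E0 : (0 <= E)%E.
  by apply: le_trans (leE 0); rewrite lee_fin mulr_ge0 ?sqr_ge0 ?powR_ge0.
move: es leE E0; rewrite -/E; case: E => [y||]// _ leE y0; rewrite lee_fin in y0.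
(* With [t] below, |t z|^s = a, so the expression in the supremum is at least delta^2 a = y + 1,
   above its supposed value y. *)
pose a := (y + 1) / delta ^+ 2.
have a0 : 0 < a by rewrite divr_gt0 ?exprn_gt0// ltr_wpDl.
pose t := a `^ s^-1 / enorm z.
have t0 : 0 <= t by rewrite divr_ge0 ?powR_ge0// ltW.
have := leE (t *: z).
have -> : enorm (t *: z) = a `^ s^-1.
  rewrite /enorm dotpZl dotpC dotpZl mulrA -expr2 sqrtrM ?sqr_ge0//.
  by rewrite sqrtr_sqr ger0_norm// -/(enorm z) divfK// gt_eqF.
rewrite -powRrM mulVf ?gt_eqF// powRr1 ?(ltW a0)// lee_fin.
apply/negP; rewrite -ltNge nuE -scalemxAl zM scaler0.
have h0 : delta <= fourier_modulus mu 0.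
  by apply: hdelta; rewrite /cube/= normr0 ltW.
apply: (@lt_le_trans _ _ (delta ^+ 2 * a)).
  by rewrite /a mulrC divfK ?ltrDl// gt_eqF// exprn_gt0.
rewrite ler_wpM2r ?(ltW a0)// lerXn2r ?nnegrE ?(ltW delta0)//.
exact: fourier_modulus_ge0.
Qed.

Lemma dimF_isometry theta : 0 <= theta <= 1 ->
  dimF theta nu = mine (theta * k%:R)%:E (dimF theta mu).
Proof.
move=> /andP[theta_ge0 _]; have [<-|theta_neq0] := eqVneq 0 theta.
  by rewrite dimF0_isometry mul0r min_l// dimF_ge0.
have theta0 : 0 < theta by rewrite lt_neqAle theta_neq0.
have [delta [r [delta0 r0 hdelta]]] := fourier_modulus_lower_bound mu0.
pose psi (u : 'rV[R]_k) := fourier_modulus mu u `^ (2 / theta).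
have q0 : 0 <= 2 / theta by rewrite divr_ge0// ltW.
have mpsi : measurable_fun setT (psi : _ -> measurableTypeR R).
  by apply: (measurableT_comp (measurable_powR _)); exact: measurable_fourier_modulus.
have psi0 u : 0 <= psi u by exact: powR_ge0.
pose T := (2 * fine (mu setT)) `^ (2 / theta).
have psiT u : 0 <= psi u <= T.
  rewrite psi0/= ge0_ler_powR ?nnegrE ?fourier_modulus_ge0 ?fourier_modulus_le//.
  by rewrite mulr_ge0// fine_ge0.
have psidelta u : cube r u -> delta `^ (2 / theta) <= psi u.
  move=> ur; rewrite ge0_ler_powR ?nnegrE ?fourier_modulus_ge0 ?(ltW delta0)//.
  exact: hdelta.
have eMu s : (energy s theta mu < +oo)%E <-> (riesz_energy psi (s / theta)%R < +oo)%E.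
  exact: energy_lty.
pose psid (z : 'rV[R]_d) := psi (z *m M^T).
have mpsid : measurable_fun setT (psid : _ -> measurableTypeR R).
  by apply: (measurableT_comp mpsi); exact: measurable_mulmx_rV.
have eNu s : (energy s theta nu < +oo)%E <-> (riesz_energy psid (s / theta)%R < +oo)%E.
  apply: (iff_trans (energy_lty _ _ theta0)).
  have -> : (fun z => fourier_modulus nu z `^ (2 / theta)) = psid.
    by apply/funext => z; rewrite nuE.
  by [].
have eNuMu s : s < theta * k%:R ->
    (energy s theta nu < +oo)%E <-> (energy s theta mu < +oo)%E.
  move=> sk; apply: (iff_trans (eNu s)); apply: iff_trans (iff_sym (eMu s)).
  apply: riesz_energy_isometry => //.
  by rewrite ltr_pdivrMr// mulrC.
have monoMu s t : 0 < t <= s -> (energy s theta mu < +oo)%E ->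
    (energy t theta mu < +oo)%E.
  move=> /andP[t0 ts] /eMu h; apply/eMu.
  apply: riesz_energy_lty_le k0 mpsi psiT _ h.
  by rewrite divr_gt0// ler_pM2r ?invr_gt0.
have d0 : (0 < d)%N by rewrite (leq_ltn_trans _ kd).
have monoNu s t : 0 < t <= s -> (energy s theta nu < +oo)%E ->
    (energy t theta nu < +oo)%E.
  move=> /andP[t0 ts] /eNu h; apply/eNu.
  apply: riesz_energy_lty_le d0 mpsid (fun z => psiT _) _ h.
  by rewrite divr_gt0// ler_pM2r ?invr_gt0.
have leNu s : 0 < s -> (energy s theta nu < +oo)%E -> s <= theta * k%:R.
  move=> s0 es; rewrite leNgt; apply/negP => sk.
  have kd' : k%:R < d%:R :> R by rewrite ltr_nat.
  (* Truncating s at theta d brings e into the range k < e <= d of the divergence result. *)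
  have : (energy (Num.min s (theta * d%:R))%R theta nu < +oo)%E.
    apply: monoNu es; rewrite lt_min s0 mulr_gt0 ?ltr0n//=.
    by rewrite ge_min lexx.
  move/eNu; rewrite (@riesz_energy_isometry_pinfty R k d M psi MM k0 mpsi psi0 _
    (delta `^ (2 / theta)) r)//; last exact: powR_gt0.
  rewrite ltr_pdivlMr// ler_pdivrMr// lt_min ge_min.
  by rewrite mulrC sk ltr_pM2l// kd' mulrC lexx orbT.
have thk0 : 0 <= theta * k%:R by rewrite mulr_ge0// ltW.
apply/eqP; rewrite eq_le; apply/andP; split.
  apply: dimF_leP => [|s s0 es]; first by rewrite le_min lee_fin thk0 dimF_ge0.
  rewrite le_min lee_fin leNu//= leNgt; apply/negP => hs.
  have := dimF_ge0 theta mu; move: hs.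
  case E : (dimF theta mu) => [y||]//; rewrite lte_fin lee_fin => ys y0.
  (* The midpoint still exceeds y but is strictly below s <= theta k, where the two energies are
     finite together. *)
  have : (((y + s) / 2)%:E <= dimF theta mu)%E.
    apply: le_dimF; first by lra.
    apply/eNuMu; first by have := leNu _ s0 es; lra.
    by apply: monoNu es; lra.
  by rewrite E lee_fin; lra.
rewrite leNgt; apply/negP => hlt.
have := dimF_ge0 theta nu; move: hlt.
case E : (dimF theta nu) => [y||]//; last by rewrite ltNge leey.
rewrite lee_fin lt_min => /andP[yk ymu] y0.
have [_ [->|[s [s0 es] <-]]] := ereal_sup_gt ymu; first by rewrite lte_fin ltNge y0.
rewrite lte_fin => ys; rewrite lte_fin in yk.
(* Again a midpoint, to be strictly below theta k while exceeding the supposed dimension y of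
   [nu]. *)
pose t := (y + Num.min s (theta * k%:R)) / 2.
have yt : y < t.
  have : y < Num.min s (theta * k%:R) by rewrite lt_min ys yk.
  by rewrite /t; lra.
have [ts tk] : t < s /\ t < theta * k%:R.
  have h1 : Num.min s (theta * k%:R) <= s by rewrite ge_min lexx.
  have h2 : Num.min s (theta * k%:R) <= theta * k%:R by rewrite ge_min lexx orbT.
  by rewrite /t; split; lra.
have : (t%:E <= dimF theta nu)%E.
  apply: le_dimF; first exact: ltW (le_lt_trans y0 yt).
  apply/(eNuMu _ tk); apply: (monoMu s t) es.
  by rewrite (le_lt_trans y0 yt) ltW.
by rewrite E lee_fin leNgt yt.
Qed.

End dimension.

(** * Isometric embeddings of Euclidean spaces are affine *)

Section isometric_embeddings.
Context {R : realType}.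

(* Polarization: x |-> f x - f 0 preserves the dot product, hence sends the
   standard basis to the orthonormal rows of M and agrees with x |-> x M. *)
Lemma isometric_embedding_affine k d (f : 'rV[R]_k -> 'rV[R]_d) :
  isometric_embedding f -> exists (b : 'rV[R]_d) (M : 'M[R]_(k, d)),
    M *m M^T = 1%:M /\ f = (fun x => b + x *m M).
Proof.
move=> hf; have [g gE] : exists g : 'rV[R]_k -> 'rV[R]_d, forall x, g x = f x - f 0.
  by exists (fun x => f x - f 0).
have gg x y : dotp (g x - g y) (g x - g y) = dotp (x - y) (x - y).
  by rewrite -!enorm_sqr !gE opprB addrA subrK hf.
have g0 : g 0 = 0 by rewrite gE subrr.
have sq n (a b : 'rV[R]_n) :
    dotp (a - b) (a - b) = dotp a a - 2 * dotp a b + dotp b b.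
  rewrite dotpDl dotpNl ![dotp _ (a - b)]dotpC !dotpDl !dotpNl (dotpC b a); ring.
have gn x : dotp (g x) (g x) = dotp x x by have := gg x 0; rewrite g0 !subr0.
have gd x y : dotp (g x) (g y) = dotp x y.
  by have := gg x y; rewrite !sq !gn; lra.
pose M : 'M[R]_(k, d) := \matrix_i g (delta_mx 0 i).
have gM x i : dotp (g x) (row i M) = x ord0 i.
  rewrite rowK gd /dotp (bigD1 i)//= big1 ?addr0 => [|j ji].
    by rewrite mxE !eqxx mulr1.
  by rewrite mxE (negbTE ji) andbF mulr0.
have gMT x : g x *m M^T = x.
  apply/rowP => i; rewrite -(gM x i) mxE; apply: eq_bigr => j _.
  by rewrite !mxE.
have MM : M *m M^T = 1%:M.
  apply/row_matrixP => i; rewrite row_mul rowK gMT.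
  by rewrite rowE mulmx1.
exists (f 0), M; split => //; apply/funext => x.
suff /subr0_eq <- : g x - x *m M = 0 by rewrite gE addrC subrK.
apply: dotpp_eq0; rewrite sq gn dotp_mulmx -mulmxA MM mulmx1.
by rewrite (dotpC (g x)) dotp_mulmx gMT; ring.
Qed.

End isometric_embeddings.

(** * Supports *)

Section supports.
Context {R : realType}.

Lemma continuous_affine_rV m n (b : 'rV[R]_n) (A : 'M[R]_(m, n)) :
  continuous (fun x : 'rV[R]_m => b + x *m A).
Proof.
have [C C0 hC] := mulmx_rV_bounded A.
move=> x; apply/(@cvgrPdist_lt _ 'rV[R]_n _ _ (nbhs_filter (x : 'rV[R]_m))) => e e0.
near=> y.
rewrite opprD addrACA subrr add0r -mulmxBl; apply: (le_lt_trans (hC _)).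
rewrite mulrC -ltr_pdivlMr//; near: y.
have := @nbhsx_ballx _ 'rV[R]_m x (e / C); rewrite mx_norm_ball; apply.
by rewrite divr_gt0.
Unshelve. all: by end_near. Qed.

(** [dimF_set] ranges over bundled finite measures, so images of measures must be rebundled to be
    competitors. *)
Lemma finite_measure_pushforward d1 d2 (T1 : measurableType d1)
    (T2 : measurableType d2) (mu : {finite_measure set T1 -> \bar R})
    (f : T1 -> T2) : measurable_fun setT f ->
  exists nu : {finite_measure set T2 -> \bar R},
    nu = pushforward mu f :> (set T2 -> \bar R).
Proof.
move=> mf.
pose nu := measure_function_pushforward__canonical__measure_function_Measure mu mf.
have H : fin_num_fun nu.
  move=> A mA; apply: fin_num_measure.
  by rewrite -[X in measurable X]setTI; exact: (mf measurableT A mA).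
have sf : sigma_finite setT nu.
  by apply: fin_num_fun_sigma_finite => //; rewrite measure0.
pose H1 := isFinite.Build _ _ _ _ H.
pose H2 := isSFinite.Build _ _ _ _ (sfinite_measure_sigma_finite sf).
pose H3 := isSigmaFinite.Build _ _ _ _ sf.
by exists (HB.pack_for (FiniteMeasure.type T2 R) (Measure.sort nu) H1 H2 H3).
Qed.

(** Every point off the support lies in a null ball with rational center and radius 1/(n+1), and
    there are countably many such balls. *)
Lemma mspt_negligible m (mu : {measure set 'rV[R]_m -> \bar R}) :
  mu.-negligible (~` mspt mu).
Proof.
pose B (q : 'rV[rat]_m * nat) : set 'rV[R]_m :=
  ball (map_mx ratr q.1 : 'rV[R]_m) (q.2.+1%:R^-1 : R).
have oB q : open (B q) by exact: ball_open.
pose F n := if unpickle n is Some q then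
  if mu (B q) == 0%E then B q else set0 else set0.
suff sub : ~` mspt mu `<=` \bigcup_n F n.
  apply: negligibleS sub _; apply: negligible_bigcup => n.
  rewrite /F; case: unpickle => [q|]; last exact: negligible_set0.
  case: ifPn => [/eqP q0|_]; last exact: negligible_set0.
  by exists (B q); split => //; exact: open_measurable_rV.
move=> y /existsNP[U /not_implyP[oU /not_implyP[Uy /negP]]].
rewrite -leNgt => muU.
have U0 : mu U = 0%E by apply/eqP; rewrite eq_le muU measure_ge0.
have /nbhs_ballP[e /= e0 eU] : nbhs y U by exact: open_nbhs_nbhs.
(* Radius below e/2: a ball of this radius containing y stays inside the e-ball around y. *)
have [n hn] : exists n, n.+1%:R^-1 < e / 2.
  exists (Num.trunc (e / 2)^-1); rewrite invf_plt ?posrE ?divr_gt0//.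
  exact: truncnS_gt.
have n0 : 0 < n.+1%:R^-1 :> R by rewrite invr_gt0.
have /choice[c hc] (i : 'I_m) : exists c : rat,
    `|ratr c - y ord0 i| < n.+1%:R^-1.
  have /rat_in_itvoo[c] : y ord0 i - n.+1%:R^-1 < y ord0 i + n.+1%:R^-1.
    by rewrite ltrD2l (lt_trans _ n0)// oppr_lt0.
  by rewrite in_itv/= => h; exists c; rewrite distrC ltr_distlC.
pose q : 'rV[rat]_m * nat := (\row_i c i, n).
have yq : B q y.
  by split => // i j; rewrite ord1 /ball/= !mxE.
have qU : B q `<=` U.
  move=> z zq; apply: eU; apply: (@ball_split _ _ (map_mx ratr q.1 : 'rV[R]_m)).
    by apply/ball_sym/(le_ball (ltW hn)).
  exact: (le_ball (ltW hn)).
exists (pickle q) => //; rewrite /F pickleK.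
have -> : mu (B q) = 0%E; last by rewrite eqxx.
apply/eqP; rewrite eq_le measure_ge0 andbT -U0.
by apply: le_measure => //; rewrite inE; exact: open_measurable_rV.
Qed.

Lemma eq_measure_mspt m (mu : {measure set 'rV[R]_m -> \bar R}) (A B : set 'rV[R]_m) :
  measurable A -> measurable B -> mspt mu `&` A = mspt mu `&` B -> mu A = mu B.
Proof.
move=> mA mB AB.
have sub (C D : set 'rV[R]_m) : measurable C -> measurable D ->
    mspt mu `&` C = mspt mu `&` D -> (mu C <= mu D)%E.
  move=> mC mD CD; have CD0 : mu (C `\` D) = 0%E.
    apply: measure_negligible; first exact: measurableD.
    apply: negligibleS (mspt_negligible mu) => x [Cx nDx] sx.
    by apply: nDx; have [] : (mspt mu `&` D) x by rewrite -CD.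
  rewrite -(setUIDK C D) measureU0//; [|exact: measurableI|exact: measurableD].
  by apply: le_measure; rewrite ?inE//; exact: measurableI.
by apply/eqP; rewrite eq_le !sub.
Qed.

End supports.

Section isometric_supports.
Context {R : realType}.
Variables (k d : nat) (b : 'rV[R]_d) (M : 'M[R]_(k, d)).
Hypothesis MM : M *m M^T = 1%:M.
Let f (x : 'rV[R]_k) : 'rV[R]_d := b + x *m M.
Let g (y : 'rV[R]_d) : 'rV[R]_k := - (b *m M^T) + y *m M^T.

Lemma affine_isometryK : cancel f g.
Proof.
by move=> x; rewrite /f /g mulmxDl addrA addNr add0r -mulmxA MM mulmx1.
Qed.

(** The range is the zero set of the continuous map y |-> f (g y) - y. Closedness lets its
    complement serve as an open null set for image measures. *)
Lemma closed_range_affine_isometry : closed (range f).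
Proof.
have -> : range f = (fun y => f (g y) - y) @^-1` [set 0].
  apply/seteqP; split => [_ [x _ <-]|y] /=; first by rewrite affine_isometryK subrr.
  by move=> /subr0_eq fgy; exists (g y).
have -> : (fun y => f (g y) - y) =
    (fun y => (b - b *m (M^T *m M)) + y *m (M^T *m M - 1%:M)).
  apply/funext => y; rewrite /f /g mulmxBr mulmx1 mulmxDl mulNmx !mulmxA.
  by rewrite !addrA.
apply: closed_comp; last first.
  exact/accessible_closed_set1/hausdorff_accessible/norm_hausdorff.
by move=> y _; exact: continuous_affine_rV.
Qed.

Lemma mspt_pushforward_affine (mu : {finite_measure set 'rV[R]_k -> \bar R}) :
  mspt (pushforward mu f) = f @` mspt mu.
Proof.
apply/seteqP; split => [y sy|_ [x sx <-]].
  have [x _ fxy] : range f y.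
    apply: contrapT => yr; have := sy (~` range f).
    move=> /(_ (closed_openC closed_range_affine_isometry) yr).
    rewrite /pushforward (_ : f @^-1` _ = set0) ?measure0 ?ltxx//.
    by apply/seteqP; split => x //=; apply; exists x.
  exists x => // U oU Ux.
  have := sy (g @^-1` U); rewrite /pushforward.
  have -> : f @^-1` (g @^-1` U) = U.
    by apply/seteqP; split => z; rewrite /preimage/= affine_isometryK.
  apply; last by rewrite -fxy /preimage/= affine_isometryK.
  by apply: open_comp => // z _; exact: continuous_affine_rV.
move=> U oU Ux; apply: sx => //.
by apply: open_comp => // z _; exact: continuous_affine_rV.
Qed.

Lemma mspt_sub_range_affine (nu : {finite_measure set 'rV[R]_d -> \bar R}) :
  mspt nu `<=` range f -> exists mu : {finite_measure set 'rV[R]_k -> \bar R},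
    [/\ mu setT = nu setT, f @` mspt mu = mspt nu &
     forall A, measurable A -> pushforward mu f A = nu A].
Proof.
move=> sr.
have [mu muE] := finite_measure_pushforward nu (measurable_affine_rV (- (b *m M^T)) M^T).
have fmu A : measurable A -> pushforward mu f A = nu A.
  move=> mA; rewrite /pushforward muE /pushforward.
  (* f o g fixes the range of f, hence the support of [nu], so [A] and its preimage under f o g have
     the same trace on that support. *)
  apply: eq_measure_mspt => //.
    rewrite -[X in measurable X]setTI; apply: measurable_affine_rV => //.
    by rewrite -[X in measurable X]setTI; exact: measurable_affine_rV.
  apply/seteqP; split => y [sy Ay]; split => //; have [x _ xy] := sr _ sy.
    by move: Ay; rewrite /preimage/= -/(g y) -/(f (g y)) -xy affine_isometryK.
  by rewrite /preimage/= -/(g y) -/(f (g y)) -xy affine_isometryK xy.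
exists mu; split => //; first by rewrite muE.
rewrite -mspt_pushforward_affine; apply/seteqP; split => y sy U oU Uy.
  by rewrite -fmu; [exact: sy|exact: open_measurable_rV].
by rewrite fmu; [exact: sy|exact: open_measurable_rV].
Qed.

End isometric_supports.

(** * Dimensions of images of measures and of sets *)

Theorem theorem2p1 (R : realType) (k d : nat) (hk : (1 <= k)%N) (hkd : (k < d)%N)
    (f : 'rV[R]_k -> 'rV[R]_d) (hf : isometric_embedding f)
    (hfA : affine_subset k (range f))
    (mu : {finite_measure set 'rV[R]_k -> \bar R}) (hmu : mu setT <> 0%E)
    (X : set 'rV[R]_k) (hX : X !=set0)
    (theta : R) (htheta : 0 <= theta <= 1) :
  dimF theta (pushforward mu f) = mine (theta * k%:R)%:E (dimF theta mu) /\
  dimF_set theta (f @` X) = mine (theta * k%:R)%:E (dimF_set theta X).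
Proof.
have [b [M [MM fE]]] := isometric_embedding_affine hf.
have dimE (nu : {finite_measure set 'rV[R]_k -> \bar R}) : nu setT <> 0%E ->
    dimF theta (pushforward nu f) = mine (theta * k%:R)%:E (dimF theta nu).
  move=> nu0; apply: (dimF_isometry hk hkd MM nu0) => // z.
  by rewrite fE fourier_modulus_pushforward_affine.
split; first exact: dimE.
have kd : (k%:R%:E <= d%:R%:E :> \bar R)%E by rewrite lee_fin ler_nat ltnW.
have thk : ((theta * k%:R)%:E <= k%:R%:E)%E.
  by rewrite lee_fin ler_piMl//; case/andP: htheta.
apply/eqP; rewrite eq_le; apply/andP; split.
  apply: ge_ereal_sup => _ [nu [nu0 snu] <-].
  have [|la [laT sla laE]] := @mspt_sub_range_affine R k d b M MM nu.
    by move=> y /snu[x _ <-]; exists x => //; rewrite fE.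
  have la0 : la setT <> 0%E by rewrite laT.
  have -> : dimF theta nu = dimF theta (pushforward la f).
    apply: eq_dimF => z; apply/esym; rewrite fE.
    pose nu' := measure_function_pushforward__canonical__measure_function_Measure
      la (measurable_affine_rV b M).
    exact: (@eq_fourier_modulus R d nu' nu).
  rewrite dimE// le_min; apply/andP; split; first by rewrite !ge_min lexx.
  (* The measure [la] competes for X with cap k; theta k <= k makes this cap harmless. *)
  apply: (@le_trans _ _ (mine (dimF theta la) k%:R%:E)).
    rewrite le_min ge_min; apply/andP; split; first by rewrite ge_min lexx orbT.
    by rewrite ge_min ge_min thk.
  apply: ereal_sup_ubound; exists la => //; split => // x sx.
  have /snu[y Xy yx] : mspt nu (f x) by rewrite -sla; exists x; rewrite // fE.
  suff <- : y = x by [].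
  by apply: (can_inj (affine_isometryK b MM)); move: yx; rewrite fE.
rewrite leNgt; apply/negP; rewrite lt_min => /andP[hlt1 hlt2].
have [_ [nu [nu0 snu] <-]] := ereal_sup_gt hlt2.
rewrite lt_min => /andP[hnu _].
have mf : measurable_fun setT f by rewrite fE; exact: measurable_affine_rV.
have [la laE] := finite_measure_pushforward nu mf.
have : (mine (dimF theta la) d%:R%:E <= dimF_set theta (f @` X))%E.
  apply: ereal_sup_ubound; exists la => //; split; first by rewrite laE.
  rewrite laE fE mspt_pushforward_affine// => _ [x sx <-].
  by exists x => //; exact: snu.
rewrite leNgt => /negP; apply.
(* The cap d is cleared because the supposed value is below theta k <= k <= d. *)
rewrite laE dimE// !lt_min hlt1 hnu/=.
exact: lt_le_trans hlt1 (le_trans thk kd).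
Qed.
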